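(* Let $\mathbf{r},\mathbf{l}\in\mathbb{Z}_+$ with $\mathbf{r}+\mathbf{l}\neq 0$, and let $\mathcal{A}=(S_1,\dots,S_{\mathbf r},U_1,\dots,U_{\mathbf l})$ be a commuting $SU$-set of order $(\mathbf{r},\mathbf{l})$ in a Hilbert space $H$ which has a spectrum of multiplicity $d$. Let $N\in\mathbb{N}$, $N\geq d$, and let $x_0,x_1,\dots,x_{N-1}$ be elements of $H$ such that $$x_i\in D(S_1^{m_1}S_2^{m_2}\cdots S_{\mathbf r}^{m_{\mathbf r}}),\qquad m_1,\dots,m_{\mathbf r}\in\mathbb{Z}_+,\ 0\le i\le N-1,$$ $$\mathop{\rm span}\{U_1^{n_1}U_2^{n_2}\cdots U_{\mathbf l}^{n_{\mathbf l}}S_1^{m_1}S_2^{m_2}\cdots S_{\mathbf r}^{m_{\mathbf r}}x_i:\ m_1,\dots,m_{\mathbf r}\in\mathbb{Z}_+;\ n_1,\dots,n_{\mathbf l}\in\mathbb{Z};\ 0\le i\le N-1\}=H.$$ Set $$M(\delta)=\left((E(\delta)x_i,x_j)_H\right)_{i,j=0}^{N-1},\qquad \delta\in\mathfrak{B}(D_{\mathbf r,\mathbf l}),$$ where $E$ is the spectral measure of $\mathcal{A}$. Then there exists a unitary transformation $V$ which maps $L^2(M)$ onto $H$ such that $$V^{-1}S_jV=X_j,\quad 1\le j\le\mathbf{r};\qquad V^{-1}U_kV=W_k,\quad 1\le k\le\mathbf{l}.$$ Moreover, $$V\vec e_s=x_s,\qquad 0\le s\le N-1.$$ (If $\mathbf{r}=0$,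 the domain condition on the $x_i$ and the relations for $S_j$ are removed and the operators $S_j$ do not appear in the span condition; if $\mathbf{l}=0$, the relations for $U_k$ are removed and the operators $U_k$ do not appear in the span condition.)
   Context: All Hilbert spaces are complex and separable. $\mathbb{Z}_+$ denotes the non-negative integers, $\mathbb{N}$ the positive integers. $D(T)$ is the domain of an operator $T$. $\mathop{\rm span}$ denotes the closed linear span. $\mathfrak{B}(S)$ is the family of Borel subsets of $S$. For $r,l\in\mathbb{Z}_+$, $D_{r,l}=\mathbb{R}^r\times[-\pi,\pi)^l$, with elements $u=(x,\varphi)$, $x=(x_1,\dots,x_r)$, $\varphi=(\varphi_1,\dots,\varphi_l)$; $D_{r,0}=\mathbb{R}^r$, $D_{0,l}=[-\pi,\pi)^l$. $SU$-set: a tuple $\mathcal{A}=(S_1,\dots,S_{\mathbf r},U_1,\dots,U_{\mathbf l})$ where $S_j$ are (possibly unbounded) self-adjoint operators and $U_k$ are unitary operators in $H$ is called an $SU$-set of order $(\mathbf{r},\mathbf{l})$ (no $S_j$ if $\mathbf r=0$, no $U_k$ if $\mathbf l=0$). It is called commuting if $U_kU_m=U_mU_k$ for all $k,m$; $U_kS_j\subset S_jU_k$ for all $j,k$; and the spectral measures of the $S_j$ pairwise commute. In this case there is a spectral measure $E(\delta)$, $\delta\in\mathfrak{B}(D_{\mathbf r,\mathbf l})$ (orthogonal projection-valued), with $S_j=\int_{D_{\mathbf r,\mathbf l}}x_j\,dE$ for $1\le j\le\mathbf r$ and $U_k=\int_{D_{\mathbf r,\mathbf l}}e^{i\varphi_k}\,dE$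 for $1\le k\le\mathbf l$; $E$ is called the spectral measure of $\mathcal{A}$. Multiplicity: a commuting $SU$-set $\mathcal{A}$ of order $(\mathbf r,\mathbf l)$ has a spectrum of multiplicity $d$ ($d\in\mathbb{Z}_+$) if 1) there exist vectors $h_0,\dots,h_{d-1}\in H$ such that $h_i\in D(S_1^{m_1}\cdots S_{\mathbf r}^{m_{\mathbf r}})$ for all $m_1,\dots,m_{\mathbf r}\in\mathbb{Z}_+$, $0\le i\le d-1$, and $\mathop{\rm span}\{U_1^{n_1}\cdots U_{\mathbf l}^{n_{\mathbf l}}S_1^{m_1}\cdots S_{\mathbf r}^{m_{\mathbf r}}h_i:\ m_j\in\mathbb{Z}_+,\ n_k\in\mathbb{Z},\ 0\le i\le d-1\}=H$; and 2) (minimality) for any $\widetilde d\in\mathbb{Z}_+$ with $\widetilde d<d$ and any $\widetilde h_0,\dots,\widetilde h_{\widetilde d-1}\in H$, at least one of the two conditions in 1), with $\widetilde d,\widetilde h_i$ in place of $d,h_i$, fails. (If $\mathbf r=0$ the domain condition is redundant and the $S_j$ are omitted; if $\mathbf l=0$ the $U_k$ are omitted.) Space $L^2(M)$: let $M=(m_{i,j})_{i,j=0}^{N-1}$ be a measure on $\mathfrak{B}(D_{r,l})$ with values in the nonnegative Hermitian $N\times N$ complex matrices, $\tau_M=\sum_{k=0}^{N-1}m_{k,k}$, and $M'_\tau=(dm_{k,l}/d\tau_M)_{k,l=0}^{N-1}$ the matrix of Radon–Nikodym derivatives. $L^2(M)$ is the Hilbert space of equivalence classes of (measurable) row-vector-valued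 functions $f=(f_0,\dots,f_{N-1}):D_{r,l}\to\mathbb{C}^{1\times N}$ with $\|f\|^2=\int f(u)M'_\tau(u)f^*(u)\,d\tau_M<\infty$ (functions being identified when the norm of their difference is $0$), with scalar product $(f,g)_{L^2(M)}=\int f(u)M'_\tau(u)g^*(u)\,d\tau_M$. Operators in $L^2(M)$ (here $D_{r,l}=D_{\mathbf r,\mathbf l}$): $W_nf(x,\varphi)=e^{i\varphi_n}f(x,\varphi)$ for $f\in L^2(M)$, $1\le n\le\mathbf l$; $X_mf(x,\varphi)=x_mf(x,\varphi)$ with domain $\{f\in L^2(M):\ x_mf\in L^2(M)\}$, $1\le m\le\mathbf r$. $W_n$ is unitary and $X_m$ is self-adjoint. $\vec e_s=(\delta_{0,s},\delta_{1,s},\dots,\delta_{N-1,s})$, $0\le s\le N-1$, is the constant function equal to the $s$-th standard basis row vector. *)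

(* Defs.v *)
From HB Require Import structures.
From mathcomp Require Import all_boot all_order all_algebra.
From mathcomp Require Import sesquilinear complex.
From mathcomp Require Import all_classical all_reals all_analysis.
From mathcomp Require Import measurable_realfun.
From mathcomp Require Import ring lra.
Set Implicit Arguments.
Unset Strict Implicit.
Unset Printing Implicit Defensive.
Import Order.TTheory GRing.Theory Num.Theory.
Import numFieldNormedType.Exports.
Local Open Scope classical_set_scope.
Local Open Scope ring_scope.

Local Notation Re := complex.Re.
Local Notation Im := complex.Im.


Section sesqui.
Context (R : realType) (N : nat).
Local Notation C := R[i].
Implicit Types (P : 'M[C]_N) (u v w : 'rV[C]_N).

(* u P v^*, for row vectors u and v *)
Definition mxform P u v : C := form (@Num.conj C) P u v.

Lemma mxformDl P u v w : mxform P (u + v) w = mxform P u w + mxform P v w.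
Proof. by rewrite /mxform /form mulmxDl mulmxDl mxE. Qed.

Lemma mxformDr P u v w : mxform P w (u + v) = mxform P w u + mxform P w v.
Proof. by rewrite /mxform /form linearD /= map_mxD mulmxDr mxE. Qed.

Lemma mxformZl P a u v : mxform P (a *: u) v = a * mxform P u v.
Proof. by rewrite /mxform /form -!scalemxAl mxE. Qed.

Lemma mxformZr P a u v : mxform P u (a *: v) = a^* * mxform P u v.
Proof. by rewrite /mxform /form linearZ /= map_mxZ -!scalemxAr mxE. Qed.

Lemma Re_mxform P u v : Re (mxform P u v) =
  \sum_j \sum_k ((Re (u 0 k) * Re (v 0 j) + Im (u 0 k) * Im (v 0 j)) * Re (P k j)
   - (Im (u 0 k) * Re (v 0 j) - Re (u 0 k) * Im (v 0 j)) * Im (P k j)).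
Proof.
rewrite /mxform /form mxE (raddf_sum (@complex.Re R : Rcomplex R -> R)).
apply: eq_bigr => j _; rewrite !mxE mulr_suml.
rewrite (raddf_sum (@complex.Re R : Rcomplex R -> R)); apply: eq_bigr => k _.
case: (u 0 k) (v 0 j) (P k j) => [a b] [c e] [p q] /=; ring.
Qed.

Lemma Re_mxformZl P a u v : Re (mxform P (a *: u) v) =
  Re a * Re (mxform P u v) - Im a * Im (mxform P u v).
Proof. by rewrite mxformZl; case: a (mxform _ _ _) => [a b] [c e]. Qed.

Lemma Re_mxformZr P a u v : Re (mxform P u (a *: v)) =
  Re a * Re (mxform P u v) + Im a * Im (mxform P u v).
Proof.
by rewrite mxformZr; case: a (mxform _ _ _) => [a b] [c e] /=; ring.
Qed.

Lemma Im_mxform P u v : Im (mxform P u v) = Re (mxform P u ('i%C *: v)).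
Proof. by rewrite Re_mxformZr /= mul0r add0r mul1r. Qed.

Definition pos_form P := forall v, 0 <= mxform P v v.

Definition psdmx P := P \is (hermsymmx : qualifier _ _) /\ pos_form P.

Section pos_form.
Context P (P0 : pos_form P).

Lemma pos_form_Re v : 0 <= Re (mxform P v v).
Proof. by have := P0 v; case: (mxform _ _ _) => a b; rewrite lecE => /andP[]. Qed.

Lemma pos_form_Im v : Im (mxform P v v) = 0.
Proof.
by have := P0 v; case: (mxform _ _ _) => a b; rewrite lecE => /andP[/eqP].
Qed.

Lemma pos_formC u v : mxform P v u = (mxform P u v)^*.
Proof.
have h1 := pos_form_Im (u + v).
have h2 := pos_form_Im (u + 'i%C *: v).
move: h1 h2; rewrite !(mxformDl, mxformDr, mxformZl, mxformZr).
move: (pos_form_Im u) (pos_form_Im v).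
case: (mxform P u u) (mxform P v v) (mxform P u v) (mxform P v u).
move=> a b [c e] [f g] [h k] /= -> -> h1 h2.
by apply/eqP; rewrite eq_complex/=; apply/andP; split; apply/eqP; lra.
Qed.

Lemma pos_form_Re_le u v :
  `|Re (mxform P u v)| <= Re (mxform P u u) + Re (mxform P v v).
Proof.
have h1 := pos_form_Re (u + v).
have h2 := pos_form_Re (u + (-1) *: v).
have := pos_form_Re u; have := pos_form_Re v.
move: h1 h2; rewrite !(mxformDl, mxformDr, mxformZl, mxformZr) (pos_formC u v).
case: (mxform P u u) (mxform P v v) (mxform P u v).
move=> a b [c e] [f g] /= h1 h2 h3 h4.
by rewrite ler_norml; apply/andP; split; lra.
Qed.

Lemma pos_form_ReD u v : Re (mxform P (u + v) (u + v)) <=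
  2 * (Re (mxform P u u) + Re (mxform P v v)).
Proof.
have h2 := pos_form_Re (u + (-1) *: v).
move: h2; rewrite !(mxformDl, mxformDr, mxformZl, mxformZr) (pos_formC u v).
case: (mxform P u u) (mxform P v v) (mxform P u v).
by move=> a b [c e] [f g] /= h1; lra.
Qed.

Lemma pos_form_eq0 u v : Re (mxform P u u) = 0 -> mxform P u v = 0.
Proof.
move=> u0; suff h w : Re (mxform P u w) = 0.
  by apply/eqP; rewrite eq_complex/= h Im_mxform h !eqxx.
apply/eqP/negP => /negP r0.
have := pos_form_Re ((- (Re (mxform P w w) + 1) / (2 * Re (mxform P u w)))%:C%C *: u + w).
rewrite !(mxformDl, mxformDr, mxformZl, mxformZr) (pos_formC u w).
move: u0 r0; have := pos_form_Re w.
case: (mxform P u u) (mxform P w w) (mxform P u w).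
move=> a b [c e] [f g] /= h1 -> h2.
set q := _ / _.
have : q * f = - (c + 1) / 2 by rewrite /q; field; rewrite ?h2.
by move=> qf; lra.
Qed.

End pos_form.

Lemma psdmx_eq0 P : psdmx P -> \sum_k Re (P k k) = 0 -> P = 0.
Proof.
move=> [_ P0] tr0.
have e k : mxform P (delta_mx 0 k) (delta_mx 0 k) = P k k.
  rewrite /mxform /form -rowE mxE (bigD1 k)//= big1 ?addr0; last first.
    by move=> j jk; rewrite !mxE eqxx (negbTE jk) conjC0 mulr0.
  by rewrite !mxE !eqxx conjC1 mulr1.
apply/matrixP => i j; rewrite mxE.
have <- : mxform P (delta_mx 0 i) (delta_mx 0 j) = P i j.
  rewrite /mxform /form -rowE mxE (bigD1 j)//= big1 ?addr0; last first.
    by move=> k jk; rewrite !mxE eqxx (negbTE jk) conjC0 mulr0.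
  by rewrite !mxE !eqxx conjC1 mulr1.
apply: pos_form_eq0 => //; rewrite e.
move/eqP: tr0; rewrite psumr_eq0; first by move=> /allP/(_ i (mem_index_enum _))/eqP.
by move=> k _; rewrite -e; exact: pos_form_Re.
Qed.
End sesqui.

Section mxmeasure.
Context d (T : measurableType d) (R : realType) (N : nat).
Local Notation C := R[i].

(* Measures with values in the nonnegative Hermitian N x N matrices; the values
   of M outside the sigma-algebra are irrelevant. *)
Record mxmeasure := MxMeasure {
  mxm :> set T -> 'M[C]_N ;
  mxm0 : mxm set0 = 0 ;
  mxm_psd : forall A, measurable A -> psdmx (mxm A) ;
  mxm_Re : forall i j, semi_sigma_additive (fun A => (Re (mxm A i j))%:E) ;
  mxm_Im : forall i j, semi_sigma_additive (fun A => (Im (mxm A i j))%:E) }.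

Variable M : mxmeasure.

Definition Re_mxm i j : set T -> \bar R := fun A => (Re (M A i j))%:E.
Definition Im_mxm i j : set T -> \bar R := fun A => (Im (M A i j))%:E.

Section charges.
Variables i j : 'I_N.

Let re0 : Re_mxm i j set0 = 0%E.
Proof. by rewrite /Re_mxm mxm0 mxE. Qed.

Let im0 : Im_mxm i j set0 = 0%E.
Proof. by rewrite /Im_mxm mxm0 mxE. Qed.

Let refin A : measurable A -> Re_mxm i j A \is a fin_num.
Proof. by []. Qed.

Let imfin A : measurable A -> Im_mxm i j A \is a fin_num.
Proof. by []. Qed.

HB.instance Definition _ := isCharge.Build d T R (Re_mxm i j)
  re0 refin (@mxm_Re M i j).
HB.instance Definition _ := isCharge.Build d T R (Im_mxm i j)
  im0 imfin (@mxm_Im M i j).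
End charges.

(* tau_M; a library measure is a function on all sets and has to be nonnegative
   everywhere, hence the value 0 outside the sigma-algebra. *)
Definition trace_measure (A : set T) : \bar R :=
  if `[< measurable A >] then (\sum_k Re (M A k k))%:E else 0%E.

Let trE A : measurable A -> trace_measure A = (\sum_k Re (M A k k))%:E.
Proof. by move=> mA; rewrite /trace_measure asboolT. Qed.

Let tr0 : trace_measure set0 = 0%E.
Proof. by rewrite trE// big1// => k _; rewrite mxm0 mxE. Qed.

Lemma mxm_diag_ge0 A k : measurable A -> 0 <= Re (M A k k).
Proof.
move=> mA; have [_ /(_ (delta_mx 0 k))] := mxm_psd M mA.
rewrite /mxform /form -rowE mxE (bigD1 k)//= big1 ?addr0; last first.
  by move=> j jk; rewrite !mxE eqxx (negbTE jk) conjC0 mulr0.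
by rewrite !mxE !eqxx conjC1 mulr1; case: (M A k k) => a b /=; rewrite lecE => /andP[].
Qed.

Let tr_ge0 A : (0 <= trace_measure A)%E.
Proof.
have [mA|nmA] := pselect (measurable A); last by rewrite /trace_measure asboolF.
by rewrite trE// lee_fin sumr_ge0// => k _; exact: mxm_diag_ge0.
Qed.

Let tr_sigma : semi_sigma_additive trace_measure.
Proof.
move=> F mF tF mUF; rewrite trE//.
rewrite (_ : (fun n => _) =
    fun n => (\sum_k (\sum_(0 <= i < n) Re_mxm k k (F i)))%E); last first.
  apply/funext => n; rewrite exchange_big/=; apply: eq_bigr => i _.
  by rewrite trE// sumEFin.
elim: (index_enum _) => [|k s ih].
  by under eq_fun do rewrite big_nil; rewrite big_nil; exact: cvg_cst.
under eq_fun do rewrite big_cons; rewrite big_cons EFinD.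
apply: cvgeD => //; exact: mxm_Re.
Qed.

HB.instance Definition _ := isMeasure.Build _ T R trace_measure
  tr0 tr_ge0 tr_sigma.

Let tr_fin : fin_num_fun trace_measure.
Proof. by move=> A mA; rewrite trE. Qed.

HB.instance Definition _ := @Measure_isFinite.Build _ T R trace_measure tr_fin.

Let tr_eq0 A : measurable A -> trace_measure A = 0%E -> M A = 0.
Proof.
by move=> mA; rewrite trE// => -[] /psdmx_eq0; apply; exact: mxm_psd.
Qed.

Lemma Re_mxm_dominates i j : Re_mxm i j `<< trace_measure.
Proof.
apply/null_content_dominatesP => A mA /(tr_eq0 mA) MA0.
by rewrite /Re_mxm MA0 mxE.
Qed.

Lemma Im_mxm_dominates i j : Im_mxm i j `<< trace_measure.
Proof.
apply/null_content_dominatesP => A mA /(tr_eq0 mA) MA0.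
by rewrite /Im_mxm MA0 mxE.
Qed.

Local Open Scope charge_scope.

(* dM / dtau_M; the derivative of a complex measure is taken separately on its
   real and imaginary parts, which are charges. *)
Definition mxderiv (t : T) : 'M[C]_N := \matrix_(i, j)
  (fine (('d (Re_mxm i j) '/d trace_measure) t)
   +i* fine (('d (Im_mxm i j) '/d trace_measure) t))%C.

Local Notation tau := trace_measure.

Lemma integrable_Re_mxderiv i j :
  tau.-integrable setT (fun t => (Re (mxderiv t i j))%:E).
Proof.
apply: eq_integrable (Radon_Nikodym_integrable (@Re_mxm_dominates i j)) => //.
move=> t _; rewrite mxE/= fineK//; apply: Radon_Nikodym_fin_num.
exact: Re_mxm_dominates.
Qed.

Lemma integrable_Im_mxderiv i j :
  tau.-integrable setT (fun t => (Im (mxderiv t i j))%:E).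
Proof.
apply: eq_integrable (Radon_Nikodym_integrable (@Im_mxm_dominates i j)) => //.
move=> t _; rewrite mxE/= fineK//; apply: Radon_Nikodym_fin_num.
exact: Im_mxm_dominates.
Qed.

Lemma integral_Re_mxderiv i j A : measurable A ->
  (\int[tau]_(t in A) (Re (mxderiv t i j))%:E = (Re (M A i j))%:E)%E.
Proof.
move=> mA; rewrite -[RHS]/(Re_mxm i j A).
rewrite (Radon_Nikodym_integral (@Re_mxm_dominates i j))//.
apply: eq_integral => t _; rewrite mxE/= fineK//; apply: Radon_Nikodym_fin_num.
exact: Re_mxm_dominates.
Qed.

Lemma integral_Im_mxderiv i j A : measurable A ->
  (\int[tau]_(t in A) (Im (mxderiv t i j))%:E = (Im (M A i j))%:E)%E.
Proof.
move=> mA; rewrite -[RHS]/(Im_mxm i j A).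
rewrite (Radon_Nikodym_integral (@Im_mxm_dominates i j))//.
apply: eq_integral => t _; rewrite mxE/= fineK//; apply: Radon_Nikodym_fin_num.
exact: Im_mxm_dominates.
Qed.

Lemma measurable_Re_mxderiv i j :
  measurable_fun setT (fun t => Re (mxderiv t i j)).
Proof. exact/measurable_EFinP/(measurable_int _ (integrable_Re_mxderiv i j)). Qed.

Lemma measurable_Im_mxderiv i j :
  measurable_fun setT (fun t => Im (mxderiv t i j)).
Proof. exact/measurable_EFinP/(measurable_int _ (integrable_Im_mxderiv i j)). Qed.

Lemma integrable_Re_mxform u v :
  tau.-integrable setT (fun t => (Re (mxform (mxderiv t) u v))%:E).
Proof.
under eq_fun do rewrite Re_mxform -sumEFin.
apply: (integrable_sum measurableT) => j _; under eq_fun do rewrite -sumEFin.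
apply: (integrable_sum measurableT) => k _.
under eq_fun do rewrite EFinB !EFinM.
apply: integrableB => //; apply: integrableZl => //.
- exact: integrable_Re_mxderiv.
- exact: integrable_Im_mxderiv.
Qed.

Lemma integral_Re_mxform u v A : measurable A ->
  (\int[tau]_(t in A) (Re (mxform (mxderiv t) u v))%:E
   = (Re (mxform (M A) u v))%:E)%E.
Proof.
move=> mA; have iA f : tau.-integrable setT f -> tau.-integrable A f.
  exact: integrableS.
rewrite Re_mxform -sumEFin.
under eq_integral do rewrite Re_mxform -sumEFin.
have iRe c k j : tau.-integrable A (fun t => c%:E * (Re (mxderiv t k j))%:E)%E.
  by apply: integrableZl => //; exact/iA/integrable_Re_mxderiv.
have iIm c k j : tau.-integrable A (fun t => c%:E * (Im (mxderiv t k j))%:E)%E.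
  by apply: integrableZl => //; exact/iA/integrable_Im_mxderiv.
have i1 c c' k j : tau.-integrable A (fun t =>
    (c * Re (mxderiv t k j) - c' * Im (mxderiv t k j))%:E).
  by under eq_fun do rewrite EFinB !EFinM; exact: integrableB.
rewrite integral_sum//; last first.
  move=> j; under eq_fun do rewrite -sumEFin.
  by apply: (integrable_sum mA) => k _; exact: i1.
apply: eq_bigr => j _; rewrite -sumEFin; under eq_integral do rewrite -sumEFin.
rewrite integral_sum//; apply: eq_bigr => k _.
under eq_integral do rewrite EFinB !EFinM.
rewrite integralB//.
rewrite !integralZl//; try exact/iA/integrable_Re_mxderiv; try exact/iA/integrable_Im_mxderiv.
by rewrite integral_Re_mxderiv// integral_Im_mxderiv.
Qed.

End mxmeasure.

Section ae_pos_form.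
Context d (T : measurableType d) (R : realType) (N : nat).
Variable M : mxmeasure T R N.
Local Notation C := R[i].
Local Notation tau := (trace_measure M).
Local Notation mxderiv := (mxderiv M).

Lemma ae_ge0_mxderiv (g : T -> R) : tau.-integrable setT (EFin \o g) ->
  (forall A, measurable A -> (0 <= \int[tau]_(t in A) (g t)%:E)%E) ->
  {ae tau, forall t, 0 <= g t}.
Proof.
move=> ig g0; have mg : measurable_fun setT g by exact/measurable_EFinP/(measurable_int _ ig).
pose E0 := [set t | g t < 0].
have mE0 : measurable E0.
  rewrite (_ : E0 = setT `&` g @^-1` `]-oo, 0[%classic); first exact: mg.
  by apply/seteqP; split=> t /=; rewrite /E0/= in_itv/= => // -[].
have : ae_eq tau E0 (EFin \o g) (cst 0%E).
  apply: integral_ae_eq => //; first exact: integrableS ig.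
  move=> E EE0 mE; rewrite integral0; apply/eqP; rewrite eq_le g0// andbT.
  rewrite -[leRHS](integral0 tau E); apply: le_integral => //.
  - by apply: integrableS ig.
  - exact: integrable0.
  - by move=> t /set_mem/EE0 t0; rewrite lee_fin ltW.
apply: filterS => t /= h; rewrite leNgt; apply/negP => gt0.
by move: (h gt0) => -[g0']; rewrite g0' ltxx in gt0.
Qed.

Lemma integral_Im_mxform u A : measurable A ->
  (\int[tau]_(t in A) (Im (mxform (mxderiv t) u u))%:E = 0)%E.
Proof.
move=> mA; under eq_integral do rewrite Im_mxform.
rewrite integral_Re_mxform// -Im_mxform pos_form_Im//.
by have [] := mxm_psd M mA.
Qed.

Lemma ae_pos_form1 u : {ae tau, forall t, 0 <= mxform (mxderiv t) u u}.
Proof.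
have h1 : {ae tau, forall t, 0 <= Re (mxform (mxderiv t) u u)}.
  apply: ae_ge0_mxderiv; first exact: integrable_Re_mxform.
  move=> A mA; rewrite integral_Re_mxform// lee_fin; apply: pos_form_Re.
  by have [] := mxm_psd M mA.
have iIm : tau.-integrable setT (fun t => (Im (mxform (mxderiv t) u u))%:E).
  by under eq_fun do rewrite Im_mxform; exact: integrable_Re_mxform.
have h2 : {ae tau, forall t, 0 <= Im (mxform (mxderiv t) u u)}.
  by apply: ae_ge0_mxderiv => // A mA; rewrite integral_Im_mxform.
have h3 : {ae tau, forall t, 0 <= - Im (mxform (mxderiv t) u u)}.
  apply: ae_ge0_mxderiv => [|A mA]; first exact: (integrableN iIm).
  under eq_integral do rewrite EFinN.
  rewrite integralN/= ?integral_Im_mxform ?oppe0//.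
  apply: integrable_add_def => //.
  exact: integrableS iIm.
near=> t.
have t1 : 0 <= Re (mxform (mxderiv t) u u) by near: t.
have t2 : 0 <= Im (mxform (mxderiv t) u u) by near: t.
have t3 : 0 <= - Im (mxform (mxderiv t) u u) by near: t.
move: t1 t2 t3; case: (mxform _ _ _) => a b /= a0 b0 Nb0.
by rewrite lecE/= a0 andbT; apply/eqP; lra.
Unshelve. all: by end_near.
Qed.

Definition ratrV (q : 'rV[rat * rat]_N) : 'rV[C]_N :=
  \row_j (ratr (q 0 j).1 +i* ratr (q 0 j).2)%C.

Lemma ratr_dense (x : R) : exists q : nat -> rat, (fun n => ratr (q n) : R) @ \oo --> x.
Proof.
have h n : exists q : rat, (ratr q : R) \in `]x, x + n.+1%:R^-1[.
  by apply: rat_in_itvoo; rewrite ltrDl invr_gt0.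
have [q qE] := choice h; exists q.
apply: (@squeeze_cvgr _ _ _ _ (cst x) (fun n => x + n.+1%:R^-1)).
- near=> n; have := qE n; rewrite in_itv/= => /andP[/ltW -> /ltW ->] //.
- exact: cvg_cst.
- rewrite -[X in _ --> X]addr0; apply: cvgD; first exact: cvg_cst.
  exact: cvg_harmonic.
Unshelve. all: by end_near.
Qed.

Lemma cvg_bigsum (I : Type) (s : seq I) (f : I -> nat -> R) (l : I -> R) :
  (forall i, f i @ \oo --> l i) ->
  (fun n => \sum_(i <- s) f i n) @ \oo --> \sum_(i <- s) l i.
Proof.
move=> fl; elim: s => [|i s ih].
  by under eq_fun do rewrite big_nil; rewrite big_nil; exact: cvg_cst.
by under eq_fun do rewrite big_cons; rewrite big_cons; exact: cvgD.
Qed.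

Lemma ratrV_dense (v : 'rV[C]_N) : exists q : nat -> 'rV[rat * rat]_N,
  forall P, (fun n => Re (mxform P (ratrV (q n)) (ratrV (q n)))) @ \oo
    --> Re (mxform P v v).
Proof.
have [a aE] := choice (fun j => ratr_dense (Re (v 0 j))).
have [b bE] := choice (fun j => ratr_dense (Im (v 0 j))).
exists (fun n => \row_j (a j n, b j n)) => P.
under eq_fun do rewrite Re_mxform.
rewrite Re_mxform; apply: cvg_bigsum => j; apply: cvg_bigsum => k.
have ha i : (fun n => Re (ratrV (\row_j (a j n, b j n)) 0 i)) @ \oo --> Re (v 0 i).
  by under eq_fun do rewrite !mxE/=; exact: aE.
have hb i : (fun n => Im (ratrV (\row_j (a j n, b j n)) 0 i)) @ \oo --> Im (v 0 i).
  by under eq_fun do rewrite !mxE/=; exact: bE.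
apply: cvgB; apply: cvgM; [|exact: cvg_cst| |exact: cvg_cst].
- by apply: cvgD; apply: cvgM.
- by apply: cvgB; apply: cvgM.
Qed.

Lemma ratrV_pos_form P :
  (forall q, 0 <= mxform P (ratrV q) (ratrV q)) -> pos_form P.
Proof.
move=> h v.
have hIm w : Im (mxform P w w) = - Re (mxform ('i%C *: P) w w).
  rewrite /mxform /form -scalemxAr -scalemxAl [in RHS]mxE.
  by case: ((w *m P *m _) 0 0) => x y /=; ring.
have [q qE] := ratrV_dense v.
have h1 : 0 <= Re (mxform P v v).
  rewrite -(cvg_lim (@Rhausdorff R) (qE P)); apply: limr_ge.
    exact: cvgP (qE P).
  by apply: nearW => n; have := h (q n); case: (mxform _ _ _) => x y; rewrite lecE => /andP[].
have h2 : Im (mxform P v v) = 0.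
  apply/eqP; rewrite hIm oppr_eq0; apply/eqP.
  rewrite -(cvg_lim (@Rhausdorff R) (qE ('i%C *: P))).
  rewrite (_ : (fun _ => _) = cst 0) ?lim_cst//.
  apply/funext => n; apply/eqP; rewrite -oppr_eq0 -hIm.
  by have := h (q n); case: (mxform _ _ _) => x y; rewrite lecE => /andP[].
by move: h1 h2; case: (mxform _ _ _) => x y /= x0 ->; rewrite lecE/= eqxx.
Unshelve. all: by end_near.
Qed.

Lemma ae_pos_form : {ae tau, forall t, pos_form (mxderiv t)}.
Proof.
have : {ae tau, forall t, forall n : nat,
    if unpickle n is Some q then
    0 <= mxform (mxderiv t) (ratrV q) (ratrV q) else true}.
  apply: ae_foralln => n; case: unpickle => [q|]; last exact: nearW.
  exact: ae_pos_form1.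
apply: filterS => t h; apply: ratrV_pos_form => q.
by have := h (pickle q); rewrite pickleK.
Qed.

End ae_pos_form.

Section L2.
Context d (T : measurableType d) (R : realType) (N : nat).
Local Notation C := R[i].

Definition measurable_rV (f : T -> 'rV[C]_N) := forall j,
  measurable_fun setT (fun t => Re (f t 0 j)) /\
  measurable_fun setT (fun t => Im (f t 0 j)).

Lemma measurable_rVD f g :
  measurable_rV f -> measurable_rV g -> measurable_rV (f + g).
Proof.
move=> mf mg j; have [mf1 mf2] := mf j; have [mg1 mg2] := mg j.
split; [under eq_fun do rewrite !mxE raddfD/=|under eq_fun do rewrite !mxE raddfD/=];
  exact: measurable_funD.
Qed.

Lemma measurable_rVZ (h : T -> C) f :
  measurable_fun setT (fun t => Re (h t)) ->
  measurable_fun setT (fun t => Im (h t)) ->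
  measurable_rV f -> measurable_rV (fun t => h t *: f t).
Proof.
move=> mh1 mh2 mf j; have [mf1 mf2] := mf j; split.
- rewrite (_ : (fun _ => _) = fun t =>
    Re (h t) * Re (f t 0 j) - Im (h t) * Im (f t 0 j)).
    by apply: measurable_funB; apply: measurable_funM.
  by apply/funext => t; rewrite mxE; case: (h t) (f t 0 j) => [? ?] [].
- rewrite (_ : (fun _ => _) = fun t =>
    Re (h t) * Im (f t 0 j) + Im (h t) * Re (f t 0 j)).
    by apply: measurable_funD; apply: measurable_funM.
  by apply/funext => t; rewrite mxE; case: (h t) (f t 0 j) => [? ?] [].
Qed.

Variable M : mxmeasure T R N.
Local Notation tau := (trace_measure M).

Definition L2form (f g : T -> 'rV[C]_N) (t : T) : C :=
  mxform (mxderiv M t) (f t) (g t).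

Lemma measurable_L2form f g : measurable_rV f -> measurable_rV g ->
  measurable_fun setT (fun t => Re (L2form f g t)).
Proof.
move=> mf mg; under eq_fun do rewrite Re_mxform.
apply: measurable_sum => j; apply: measurable_sum => k.
have [f1 f2] := mf k; have [g1 g2] := mg j.
apply: measurable_funB; apply: measurable_funM.
- by apply: measurable_funD; apply: measurable_funM.
- exact: measurable_Re_mxderiv.
- by apply: measurable_funB; apply: measurable_funM.
- exact: measurable_Im_mxderiv.
Qed.

(* The integrand f M' f^* is almost everywhere real and nonnegative, see
   ae_pos_form. *)
Definition L2fun_set : set (T -> 'rV[C]_N) := [set f | measurable_rV f /\
  (\int[tau]_t (Re (L2form f f t))%:E < +oo)%E].

Lemma ae_L2form_ge0 f : {ae tau, forall t, 0 <= Re (L2form f f t)}.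
Proof. by apply: filterS (ae_pos_form M) => t h; exact: pos_form_Re. Qed.

Lemma ae_integrable_le (f g : T -> R) : measurable_fun setT f ->
  tau.-integrable setT (EFin \o g) ->
  {ae tau, forall t, `|f t| <= g t} -> tau.-integrable setT (EFin \o f).
Proof.
move=> mf ig fg; apply/integrableP; split; first exact/measurable_EFinP.
have [mg igoo] := (integrableP _ _ _ ig).
apply: le_lt_trans igoo; apply: ae_ge0_le_integral => //.
- by apply: measurableT_comp => //; exact/measurable_EFinP.
- by apply: measurableT_comp => //; exact/measurable_EFinP.
- by apply: filterS fg => t h _; rewrite lee_fin; exact: le_trans h (ler_norm _).
Qed.

Lemma L2fun_integrable f : L2fun_set f ->
  tau.-integrable setT (fun t => (Re (L2form f f t))%:E).
Proof.
move=> [mf foo]; have mQ := measurable_L2form mf mf.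
apply/integrableP; split; first exact/measurable_EFinP.
rewrite (_ : (\int[_]_(_ in _) _ = \int[tau]_t (Re (L2form f f t))%:E)%E)//.
apply: ae_eq_integral => //; first by apply: measurableT_comp => //; exact/measurable_EFinP.
  exact/measurable_EFinP.
by apply: filterS (ae_L2form_ge0 f) => t h _; rewrite /= ger0_norm.
Qed.

Lemma L2form_integrable f g : L2fun_set f -> L2fun_set g ->
  tau.-integrable setT (fun t => (Re (L2form f g t))%:E).
Proof.
move=> lf lg; apply: (@ae_integrable_le _
    (fun t => Re (L2form f f t) + Re (L2form g g t))).
- exact: measurable_L2form lf.1 lg.1.
- apply: (integrableD measurableT (L2fun_integrable lf) (L2fun_integrable lg)).
- by apply: filterS (ae_pos_form M) => t h; exact: pos_form_Re_le.
Qed.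

Lemma L2fun_set0 : L2fun_set 0.
Proof.
split; first by move=> j; split; under eq_fun do rewrite mxE; exact: measurable_cst.
rewrite integral0_eq// => t _; congr EFin.
by rewrite /L2form/= /mxform /form !mul0mx mxE.
Qed.

Lemma L2fun_setD f g : L2fun_set f -> L2fun_set g -> L2fun_set (f + g).
Proof.
move=> lf lg; have mfg := measurable_rVD lf.1 lg.1; split => //.
apply: integrable_lty => //.
apply: (@ae_integrable_le _
    (fun t => 2 * (Re (L2form f f t) + Re (L2form g g t)))).
- exact: measurable_L2form.
- exact: (integrableZl measurableT 2
    (integrableD measurableT (L2fun_integrable lf) (L2fun_integrable lg))).
- apply: filterS (ae_pos_form M) => t h.
  by rewrite ger0_norm; [exact: pos_form_ReD|exact: pos_form_Re].
Qed.

Lemma L2fun_setZ a f : L2fun_set f -> L2fun_set (a *: f).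
Proof.
move=> lf; split.
  by apply: (@measurable_rVZ (fun=> a) f _ _ lf.1); exact: measurable_cst.
apply: integrable_lty => //.
rewrite (_ : (fun _ => _) =
    fun t => ((Re a ^+ 2 + Im a ^+ 2)%:E * (Re (L2form f f t))%:E)%E).
  by apply: integrableZl => //; exact: L2fun_integrable.
apply/funext => t; rewrite -EFinM; congr EFin.
rewrite /L2form /= mxformZl mxformZr.
by case: a (mxform _ _ _) => [x y] [p q] /=; ring.
Qed.

Definition L2fun_pred : {pred T -> 'rV[C]_N} := mem L2fun_set.

Lemma L2fun_submod_closed : submod_closed L2fun_pred.
Proof.
split; first by apply/mem_set; exact: L2fun_set0.
move=> a f g /set_mem lf /set_mem lg; apply/mem_set.
exact: L2fun_setD (L2fun_setZ a lf) lg.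
Qed.

HB.instance Definition _ := GRing.isSubmodClosed.Build C (T -> 'rV[C]_N)
  L2fun_pred L2fun_submod_closed.

Record L2fun := MkL2fun {
  L2fun_val :> T -> 'rV[C]_N ;
  L2fun_valP : L2fun_val \in L2fun_pred }.

HB.instance Definition _ := [isSub for L2fun_val].
HB.instance Definition _ := [Choice of L2fun by <:].
HB.instance Definition _ := [SubChoice_isSubLmodule of L2fun by <:].

(* the functions of norm 0 *)
Definition L2null_pred : {pred L2fun} :=
  mem [set f : L2fun | (\int[tau]_t (Re (L2form f f t))%:E = 0)%E].

Lemma L2funP (f : L2fun) : L2fun_set f.
Proof. exact/set_mem/L2fun_valP. Qed.

Lemma L2nullP (f : L2fun) : f \in L2null_pred <->
  {ae tau, forall t, Re (L2form f f t) = 0}.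
Proof.
have mQ := measurable_L2form (L2funP f).1 (L2funP f).1.
have mEQ : measurable_fun setT (fun t => (Re (L2form f f t))%:E).
  exact/measurable_EFinP.
have abs : (\int[tau]_t `|(Re (L2form f f t))%:E| =
    \int[tau]_t (Re (L2form f f t))%:E)%E.
  apply: ae_eq_integral => //; first exact: measurableT_comp.
  by apply: filterS (ae_L2form_ge0 f) => t h _; rewrite /= ger0_norm.
have := ae_eq_integral_abs tau measurableT mEQ; rewrite abs => -[h1 h2]; split.
- by move=> /set_mem/h1; apply: filterS => t /= /(_ I) [].
- move=> h; apply/mem_set/h2; apply: filterS h => t /= -> //.
Qed.

Lemma L2null_form (f g : L2fun) : f \in L2null_pred ->
  {ae tau, forall t, L2form f g t = 0}.
Proof.
move=> /L2nullP f0; near=> t.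
have P0 : pos_form (mxderiv M t) by near: t; exact: ae_pos_form.
apply: (pos_form_eq0 P0); near: t; exact: f0.
Unshelve. all: by end_near.
Qed.

Lemma L2null_submod_closed : submod_closed L2null_pred.
Proof.
split.
  apply/L2nullP; apply: nearW => t.
  by rewrite /L2form/= /mxform /form !mul0mx mxE.
move=> a f g f0 g0; apply/L2nullP; near=> t.
have e1 : L2form f (a *: f + g) t = 0.
  by near: t; exact: (L2null_form (a *: f + g) f0).
have e2 : L2form g (a *: f + g) t = 0.
  by near: t; exact: (L2null_form (a *: f + g) g0).
rewrite /L2form [X in mxform _ X _](_ : _ = a *: f t + g t)//.
by rewrite mxformDl mxformZl -!/(L2form _ (a *: f + g) _) e1 e2 mulr0 addr0.
Unshelve. all: by end_near.
Qed.

HB.instance Definition _ := GRing.isSubmodClosed.Build C L2fun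
  L2null_pred L2null_submod_closed.

End L2.

Arguments L2null_pred {d T R N} M _.

Section L2_space.
Context d (T : measurableType d) (R : realType) (N : nat).
Local Notation C := R[i].
Variable M : mxmeasure T R N.
Local Notation tau := (trace_measure M).

Local Open Scope quotient_scope.

Definition L2 : Type :=
  Quotient.quot (L2null_pred M : zmodClosed (L2fun M)).

HB.instance Definition _ := Choice.on L2.
HB.instance Definition _ := EqQuotient.on L2.
HB.instance Definition _ := GRing.Zmodule.on L2.

Definition L2class (f : L2fun M) : L2 := \pi_L2 f.

Lemma L2class_eq (f g : L2fun M) :
  L2class f = L2class g <-> (f - g) \in L2null_pred M.
Proof. by rewrite /L2class Quotient.idealrBE; split => /eqP. Qed.

Lemma L2classD (f g : L2fun M) : L2class (f + g) = L2class f + L2class g.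
Proof. exact: Quotient.pi_add. Qed.

Lemma L2classN (f : L2fun M) : L2class (- f) = - L2class f.
Proof. exact: Quotient.pi_opp. Qed.

Lemma L2class0 : L2class 0 = 0.
Proof. by rewrite -(subrr 0) L2classD L2classN subrr. Qed.

Lemma L2class_repr (F : L2) : L2class (repr F) = F.
Proof. exact: reprK. Qed.

Definition L2scale (a : C) (F : L2) : L2 := L2class (a *: repr F).

Lemma L2classZ a (f : L2fun M) : L2class (a *: f) = L2scale a (L2class f).
Proof.
apply/L2class_eq; rewrite -scalerBr; apply: rpredZ.
by apply/L2class_eq; rewrite L2class_repr.
Qed.

Let L2scaleA a b F : L2scale a (L2scale b F) = L2scale (a * b) F.
Proof. by rewrite -[F]L2class_repr -!L2classZ scalerA. Qed.

Let L2scale1 : left_id 1 L2scale.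
Proof. by move=> F; rewrite -[F]L2class_repr -L2classZ scale1r. Qed.

Let L2scaleDr : right_distributive L2scale +%R.
Proof.
move=> a F G; rewrite -[F]L2class_repr -[G]L2class_repr.
by rewrite -L2classD -!L2classZ -L2classD scalerDr.
Qed.

Let L2scaleDl F : {morph L2scale^~ F : a b / a + b}.
Proof.
by move=> a b; rewrite -[F]L2class_repr -!L2classZ -L2classD scalerDl.
Qed.

HB.instance Definition _ := GRing.Zmodule_isLmodule.Build C L2
  L2scaleA L2scale1 L2scaleDr L2scaleDl.

Definition L2pdot (f g : L2fun M) : C :=
  ((\int[tau]_t Re (L2form M f g t)) +i* (\int[tau]_t Im (L2form M f g t)))%C.

(* see L2dotE for the independence of the representatives *)
Definition L2dot (F G : L2) : C := L2pdot (repr F) (repr G).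

Let rdot (f g : L2fun M) : R := \int[tau]_t Re (L2form M f g t).

Let L2pdotE f g : L2pdot f g = (rdot f g +i* rdot f ('i%C *: g))%C.
Proof. by congr Complex; apply: eq_Rintegral => t _; rewrite Im_mxform. Qed.

Let rdotint (f g : L2fun M) :
  tau.-integrable setT (EFin \o (fun t => Re (L2form M f g t))).
Proof. by apply: L2form_integrable; exact: L2funP. Qed.

Let eq_rdot (f g f' g' : L2fun M) :
  {ae tau, forall t, Re (L2form M f g t) = Re (L2form M f' g' t)} ->
  rdot f g = rdot f' g'.
Proof.
move=> h.
have m1 : measurable_fun setT (fun t => (Re (L2form M f g t))%:E).
  have /measurable_int := rdotint f g. exact.
have m2 : measurable_fun setT (fun t => (Re (L2form M f' g' t))%:E).
  have /measurable_int := rdotint f' g'. exact.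
have hE : ae_eq tau setT (fun t => (Re (L2form M f g t))%:E)
  (fun t => (Re (L2form M f' g' t))%:E).
  by apply: filterS h => t ->.
rewrite /rdot /Rintegral.
by rewrite (@ae_eq_integral _ _ _ _ _ _ _ measurableT m1 m2 hE).
Qed.

Let rdotC f g : rdot f g = rdot g f.
Proof.
apply: eq_rdot; apply: filterS (ae_pos_form M) => t h.
by rewrite /L2form (pos_formC h); case: (mxform _ _ _).
Qed.

Let rdotDl f g h : rdot (f + g) h = rdot f h + rdot g h.
Proof.
rewrite /rdot -RintegralD//; apply: eq_Rintegral => t _.
by rewrite /L2form mxformDl raddfD.
Qed.

Let rdotZl (r : R) f g : rdot (r%:C%C *: f) g = r * rdot f g.
Proof.
rewrite /rdot -RintegralZl//; apply: eq_Rintegral => t _.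
by rewrite /L2form Re_mxformZl/= mul0r subr0.
Qed.

Let rdotii f g : rdot ('i%C *: f) ('i%C *: g) = rdot f g.
Proof.
apply: eq_Rintegral => t _; rewrite /L2form mxformZl mxformZr.
by case: (mxform _ _ _) => a b /=; ring.
Qed.

Let rdotDr f g h : rdot h (f + g) = rdot h f + rdot h g.
Proof. by rewrite rdotC rdotDl !(rdotC _ h). Qed.

Let rdotZr (r : R) f g : rdot f (r%:C%C *: g) = r * rdot f g.
Proof. by rewrite rdotC rdotZl rdotC. Qed.

Let iiN f : 'i%C *: ('i%C *: f) = (-1)%:C%C *: f :> L2fun M.
Proof. by rewrite scalerA; congr (_ *: _); simpc. Qed.

Let rdotiC f g : rdot ('i%C *: f) g = - rdot f ('i%C *: g).
Proof. by rewrite -(rdotii f) iiN rdotZr mulN1r opprK. Qed.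

Let L2pdotP a f g h : L2pdot (a *: f + g) h = a * L2pdot f h + L2pdot g h.
Proof.
rewrite !L2pdotE !rdotDl.
have aE : a *: f = (Re a)%:C%C *: f + (Im a)%:C%C *: ('i%C *: f).
  by rewrite scalerA -scalerDl; congr (_ *: _); case: a => x y; simpc.
rewrite aE !rdotDl !rdotZl !rdotiC iiN rdotZr {aE}.
move: (rdot f h) (rdot g h) (rdot f ('i%C *: h)) (rdot g ('i%C *: h)) => p q r s.
case: a => x y /=.
by apply/eqP; rewrite eq_complex/=; apply/andP; split; apply/eqP; ring.
Qed.

Let L2pdotC f g : L2pdot f g = (L2pdot g f)^*.
Proof. by rewrite !L2pdotE (rdotC f ('i%C *: g)) rdotiC rdotC. Qed.

Let rdot_null n g : n \in L2null_pred M -> rdot n g = 0.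
Proof.
move=> n0; rewrite -[RHS](mul0r (rdot g g)) -rdotZl; apply: eq_rdot.
apply: filterS (L2null_form g n0) => t ->.
by rewrite /L2form Re_mxformZl/= !mul0r subr0.
Qed.

Let eq_L2pdot f1 f2 h : L2class f1 = L2class f2 -> L2pdot f1 h = L2pdot f2 h.
Proof.
move=> /L2class_eq n0; rewrite -(subrK f2 f1) -[f1 - f2]scale1r L2pdotP.
by rewrite (L2pdotE (_ - _)) !rdot_null// mulr0 add0r.
Qed.

Lemma L2dotE f g : L2dot (L2class f) (L2class g) = L2pdot f g.
Proof.
have e1 := @eq_L2pdot _ _ (repr (L2class g)) (L2class_repr (L2class f)).
have e2 := @eq_L2pdot _ _ f (L2class_repr (L2class g)).
by rewrite /L2dot e1 [LHS]L2pdotC e2 [RHS]L2pdotC.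
Qed.

Let L2dotC F G : L2dot F G = (-1) ^+ false * (L2dot G F)^*.
Proof. by rewrite expr0 mul1r /L2dot L2pdotC. Qed.

Let L2dotP a F G K : L2dot (a *: F + G) K = a * L2dot F K + L2dot G K.
Proof.
rewrite -[F]L2class_repr -[G]L2class_repr -[K]L2class_repr.
by rewrite -[_ *: _]L2classZ -L2classD !L2dotE L2pdotP.
Qed.

Let L2dot_bilinear : bilinear_for
  (GRing.Scale.Law.clone _ _ *%R _) (GRing.Scale.Law.clone _ _ (@Num.conj C \; *%R) _) L2dot.
Proof.
split=> [K a F G|K a F G]; first exact: L2dotP.
have dotC F' : L2dot K F' = (L2dot F' K)^* by rewrite L2dotC expr0 mul1r.
rewrite [LHS]dotC L2dotP rmorphD rmorphM /=.
by rewrite (dotC F) (dotC G).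
Qed.

HB.instance Definition _ := bilinear_isBilinear.Build C L2 L2 C _ _ L2dot
  L2dot_bilinear.
HB.instance Definition _ := isHermitianSesquilinear.Build C L2 false
  (@Num.conj C) L2dot L2dotC.

Let L2dot_gt0 F : F != 0 -> 0 < L2dot F F.
Proof.
rewrite -[F]L2class_repr => F0; set f := repr F in F0 *.
rewrite L2dotE L2pdotE -[rdot f ('i%C *: f)]opprK -rdotiC.
have -> : rdot ('i%C *: f) f = 0.
  have := rdotiC f f; rewrite (rdotC f ('i%C *: f)); lra.
rewrite oppr0 ltcE/= eqxx/= lt_neqAle; apply/andP; split.
  apply: contra F0 => /eqP f0; apply/eqP; rewrite -L2class0; apply/L2class_eq.
  rewrite subr0; apply/mem_set => /=.
  rewrite -[LHS]fineK; first by rewrite -/(Rintegral _ _ _) -/(rdot f f) -f0.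
  exact: integrable_fin_num (rdotint f f).
have -> : rdot f f = \int[tau]_t `|Re (L2form M f f t)|.
  congr fine; apply: ae_eq_integral.
  - exact: measurableT.
  - exact: measurable_int (rdotint f f).
  - apply/measurable_EFinP/measurableT_comp => //.
    exact/measurable_EFinP/(measurable_int _ (rdotint f f)).
  - by apply: filterS (ae_L2form_ge0 M f) => t h _; rewrite ger0_norm.
exact: Rintegral_ge0.
Qed.

HB.instance Definition _ := isDotProduct.Build C L2 L2dot L2dot_gt0.

Lemma L2fun_basis_proof (s : 'I_N) :
  (fun=> delta_mx 0 s : 'rV[C]_N) \in @L2fun_pred _ _ _ _ M.
Proof.
apply/mem_set; split => /=.
  by move=> j; split; exact: measurable_cst.
by apply: integrable_lty => //; exact: integrable_Re_mxform.
Qed.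

Definition L2basis (s : 'I_N) : L2 := L2class (MkL2fun (L2fun_basis_proof s)).

(* Graph of the multiplication by g on its maximal domain. *)
Definition L2mul (g : T -> C) : set (L2 * L2) :=
  [set p | exists f h : L2fun M,
    (forall t, h t = g t *: f t) /\ p = (L2class f, L2class h)].

End L2_space.

Arguments L2dot {d T R N} M F G.
Arguments L2basis {d T R N} M s.
Arguments L2mul {d T R N} M g.

(* Separable complex Hilbert spaces; the scalar product is linear in its first
   argument. *)
HB.mixin Record isHilbert (R : realType) H & CompleteNormedModule R[i] H := {
  hdot : {dot H for @Num.conj R[i]} ;
  hdot_norm : forall x : H, hdot x x = `|x| ^+ 2 ;
  hilbert_separable : exists2 S : set H, countable S & dense S }.

#[short(type="hilbertType")]
HB.structure Definition Hilbert (R : realType) :=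
  {H of isHilbert R H & CompleteNormedModule R[i] H}.

Notation "'[ x , y ]" := (hdot x y) : ring_scope.

Section hilbert.
Context (R : realType) (H : hilbertType R).
Local Notation C := R[i].
Implicit Types x y z : H.

Lemma Re_hdot_ge0 x : 0 <= Re '[x, x].
Proof. by have := dnorm_ge0 (hdot : {dot H for _}) x; case: '[x, x] => a b; rewrite lecE => /andP[]. Qed.

Lemma hdotC x y : '[x, y] = '[y, x]^*.
Proof. by rewrite hermC expr0 mul1r. Qed.

Lemma Re_hdot_CS x y : Re '[x, y] ^+ 2 <= Re '[x, x] * Re '[y, y].
Proof.
have [->|y0] := eqVneq y 0; first by rewrite linear0r (_ : Re 0 = 0)// expr0n/=; rewrite linear0r mulr0.
have Qy : 0 < Re '[y, y].
  have := dnorm_gt0 (hdot : {dot H for _}) y; rewrite y0.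
  by case: '[y, y] => a b; rewrite ltcE => /andP[].
have := Re_hdot_ge0 (x + (- (Re '[x, y] / Re '[y, y]))%:C%C *: y).
rewrite linearDl !linearDr !linearZl_LR !linearZr_LR/= (hdotC y x).
move: Qy; case: '[x, x] '[y, y] '[x, y] => [a b] [c e] [f g] /= c0 h.
rewrite -subr_ge0.
have -> : a * c - f ^+ 2 = c * (a - 2 * (f / c) * f + (f / c) ^+ 2 * c).
  by field; rewrite gt_eqF.
by rewrite mulr_ge0 ?(ltW c0)//; lra.
Qed.

Lemma cvg_Re_hdot (u : nat -> H) x y : u @ \oo --> x ->
  (fun n => Re '[u n, y]) @ \oo --> Re '[x, y].
Proof.
move=> ux; apply/cvgrPdist_lt => e e0.
pose c := Re '[y, y] + 1.
have c0 : 0 < c by rewrite ltr_wpDl// Re_hdot_ge0.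
have dd : 0 < (e / c)%:C%C :> C by rewrite ltcR divr_gt0.
move/cvgrPdist_lt : ux => /(_ _ dd); apply: filterS => n un.
rewrite -raddfB -linearBl /=.
have : Re '[x - u n, x - u n] < (e / c) ^+ 2.
  have : '[x - u n, x - u n] < ((e / c)%:C%C) ^+ 2.
    by rewrite hdot_norm ltrXn2r// ltW.
  rewrite -rmorphXn /=.
  by case: '[_, _] => a b; rewrite ltcE/= => /andP[].
move=> h; rewrite -ltr_sqr ?nnegrE// ?ltW// real_normK ?num_real//.
apply: le_lt_trans (Re_hdot_CS _ _) _.
have [y0|y0] := eqVneq (Re '[y, y]) 0; first by rewrite y0 mulr0 exprn_gt0.
have Qy : 0 < Re '[y, y] by rewrite lt_neqAle eq_sym y0 Re_hdot_ge0.
apply: (@lt_le_trans _ _ ((e / c) ^+ 2 * Re '[y, y])); first by rewrite ltr_pM2r.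
rewrite expr_div_n -mulrA ler_piMr ?sqr_ge0//.
rewrite mulrC ler_pdivrMr ?exprn_gt0// mul1r /c; nra.
Qed.

Lemma Im_hdot x y : Im '[x, y] = Re '[x, 'i%C *: y].
Proof. by rewrite linearZr_LR/=; case: '[x, y] => a b /=; ring. Qed.

End hilbert.

Section operators.
Context (R : realType) (H : hilbertType R).
Local Notation C := R[i].

(* An operator, possibly unbounded, is represented by its graph, so that
   inclusion and equality of operators are those of sets. The product of
   operators is the composition of relations: (B \; A) applies A first. *)
Definition op_dom (K K' : Type) (A : set (K * K')) : set K :=
  [set x | exists y, A (x, y)].

Definition graph (K K' : Type) (f : K -> K') : set (K * K') :=
  [set p | p.2 = f p.1].

Definition op_pow (K : Type) (A : set (K * K)) (n : nat) : set (K * K) :=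
  iter n (fun B => (A \; B)%relation) (graph id).

Definition op_zpow (K : Type) (A : set (K * K)) (n : int) : set (K * K) :=
  match n with Posz n => op_pow A n | Negz n => op_pow (A^-1)%relation n.+1 end.

(* A_0 A_1 ... A_(n-1), the identity if n = 0 *)
Definition op_prod (K : Type) n (A : 'I_n -> set (K * K)) : set (K * K) :=
  \big[(fun B B' => (B \; B')%relation)/graph id]_(i < n) A i.

Definition linear_op (A : set (H * H)) : Prop :=
  [/\ A (0, 0),
      forall a x y x' y', A (x, y) -> A (x', y') ->
        A (a *: x + x', a *: y + y')
    & forall x y y', A (x, y) -> A (x, y') -> y = y'].

Definition adjoint (A : set (H * H)) : set (H * H) :=
  [set p | forall q, A q -> '[q.2, p.1] = '[q.1, p.2]].

Definition selfadjoint (A : set (H * H)) : Prop :=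
  [/\ linear_op A, dense (op_dom A) & adjoint A = A].

Definition lin_span (S : set H) : set H :=
  [set y | exists n (a : 'I_n -> C) (v : 'I_n -> H),
    (forall i, S (v i)) /\ y = \sum_i a i *: v i].

End operators.

Definition unitary (R : realType) (K K' : lmodType R[i])
    (dotK : {dot K for @Num.conj R[i]}) (dotK' : {dot K' for @Num.conj R[i]})
    (U : {linear K -> K'}) : Prop :=
  isometry dotK' dotK U /\ forall y, exists x, U x = y.

Section spectral_measure.
Context (R : realType) (H : hilbertType R) d (T : measurableType d).
Local Notation C := R[i].

(* Strongly countably additive families of orthogonal projections. *)
Record spectral_measure := SpectralMeasure {
  spm :> set T -> {linear H -> H} ;
  spm_idem : forall A, measurable A -> forall x, spm A (spm A x) = spm A x ;
  spm_sym : forall A, measurable A -> forall x y, '[spm A x, y] = '[x, spm A y] ;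
  spmT : forall x, spm setT x = x ;
  spm_sigma : forall F : nat -> set T, (forall i, measurable (F i)) ->
    trivIset setT F -> forall x,
    (fun n => \sum_(0 <= i < n) spm (F i) x) @ \oo --> spm (\bigcup_i F i) x }.

Variable E : spectral_measure.

Lemma spm0 x : E set0 x = 0.
Proof.
have h := @spm_sigma E (fun=> set0) (fun=> measurable0) (@trivIset_set0 _ _ _) x.
rewrite bigcup0// in h.
have h2 : (fun n : nat => \sum_(0 <= i < n.+1) E set0 x) @ \oo --> E set0 x.
  by rewrite (@cvg_shiftS _ (fun n : nat => \sum_(0 <= i < n) E set0 x)).
have h3 : (fun n : nat => \sum_(0 <= i < n.+1) E set0 x - \sum_(0 <= i < n) E set0 x) @ \oo --> E set0 x - E set0 x.
  exact: cvgB.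
rewrite subrr in h3.
have h4 : (fun n : nat => \sum_(0 <= i < n.+1) E set0 x - \sum_(0 <= i < n) E set0 x) = cst (E set0 x).
  by apply/funext => n; rewrite big_nat_recr//= addrAC subrr add0r.
rewrite h4 in h3.
by rewrite -(cvg_lim (@norm_hausdorff _ H) h3) lim_cst//; exact: norm_hausdorff.
Qed.

Variables (N : nat) (x : 'I_N -> H).

Definition gram (A : set T) : 'M[C]_N := \matrix_(i, j) '[E A (x i), x j].

Let gram0 : gram set0 = 0.
Proof. by apply/matrixP => i j; rewrite !mxE spm0 linear0l. Qed.

Let gram_form A u v : mxform (gram A) u v =
  '[E A (\sum_i u 0 i *: x i), \sum_j v 0 j *: x j].
Proof.
rewrite /mxform /form mxE [RHS]linear_sumr; apply: eq_bigr => j _.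
rewrite !mxE [RHS]linearZr_LR/= mulrC; congr (_ * _).
rewrite (linear_sum (E A)) [RHS]linear_sumlz.
by apply: eq_bigr => i _; rewrite !mxE linearZ_LR [RHS]linearZl_LR.
Qed.

Let gram_psd A : measurable A -> psdmx (gram A).
Proof.
move=> mA; split.
  apply/is_hermitianmxP; rewrite expr0 scale1r; apply/matrixP => i j.
  by rewrite !mxE spm_sym// hdotC.
move=> u; rewrite gram_form -spm_idem// spm_sym//; exact: dnorm_ge0.
Qed.

Let cvg_gram F y z : (forall i, measurable (F i)) -> trivIset setT F ->
  (fun n => \sum_(0 <= i < n) (Re '[E (F i) y, z])%:E)%E @ \oo -->
  (Re '[E (\bigcup_n F n) y, z])%:E.
Proof.
move=> mF tF; under eq_fun do rewrite sumEFin.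
apply: cvg_EFin; first exact: nearW.
rewrite (_ : fine \o _ = fun n => Re '[\sum_(0 <= i < n) E (F i) y, z]).
  by apply: cvg_Re_hdot; exact: spm_sigma.
apply/funext => n /=; rewrite linear_sumlz.
by elim/big_rec2: _ => [//|i a b _ ->]; rewrite raddfD.
Qed.

Let gram_Re i j : semi_sigma_additive (fun A => (Re (gram A i j))%:E).
Proof.
move=> F mF tF _; rewrite mxE; under eq_fun do under eq_bigr do rewrite mxE.
exact: cvg_gram.
Qed.

Let gram_Im i j : semi_sigma_additive (fun A => (Im (gram A i j))%:E).
Proof.
move=> F mF tF _; rewrite mxE Im_hdot.
under eq_fun do under eq_bigr do rewrite mxE Im_hdot.
exact: cvg_gram.
Qed.

Definition gram_measure : mxmeasure T R N :=
  MxMeasure gram0 gram_psd gram_Re gram_Im.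

End spectral_measure.

Section spectral_integral.
Context (R : realType) (H : hilbertType R) d (T : measurableType d).
Local Notation C := R[i].

(* \sum_i sf_val i * 1_(sf_set i), the sets need not be disjoint *)
Record simple_fun := SimpleFun {
  sf_n : nat ;
  sf_val : 'I_sf_n -> C ;
  sf_set : 'I_sf_n -> set T ;
  sf_meas : forall i, measurable (sf_set i) }.

Definition sf_eval (s : simple_fun) (t : T) : C :=
  \sum_(i < sf_n s) sf_val i * (\1_(sf_set i) t)%:C%C.

Variable E : spectral_measure H T.

Definition sf_integral (s : simple_fun) (x : H) : H :=
  \sum_(i < sf_n s) sf_val i *: E (sf_set i) x.

(* (E(.)x, x) *)
Definition scalar_measure (x : H) : set T -> \bar R :=
  trace_measure (gram_measure E (fun _ : 'I_1 => x)).

HB.instance Definition _ x := Measure.on (scalar_measure x).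

(* The operator \int g dE: its value at x is the limit of (\int s_n dE) x for
   simple functions s_n tending to g in L^2((E(.)x, x)). Such a sequence exists
   exactly when \int |g|^2 d(E(.)x, x) is finite, for g measurable, and the
   limit does not depend on it. *)
Definition spectral_integral (g : T -> C) : set (H * H) :=
  [set p | exists s : nat -> simple_fun,
    (fun n => \int[scalar_measure p.1]_t
       ((Re (sf_eval (s n) t - g t)) ^+ 2 +
        (Im (sf_eval (s n) t - g t)) ^+ 2)%:E)%E @ \oo --> 0%E /\
    (fun n => sf_integral (s n) p.1) @ \oo --> p.2].

End spectral_integral.

Definition angle_interval (R : realType) := {t : R | - pi <= t < pi}.

Lemma angle_point_proof (R : realType) : - pi <= (- pi : R) < pi.
Proof. by rewrite lexx/= gtrN// pi_gt0. Qed.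

HB.instance Definition _ (R : realType) := Choice.on (angle_interval R).
HB.instance Definition _ (R : realType) :=
  isPointed.Build (angle_interval R) (exist _ (- pi) (angle_point_proof R)).

(* [-pi, pi) with the trace of the Borel sigma-algebra *)
Definition angle (R : realType) :=
  g_sigma_algebra_preimageType (sval : angle_interval R -> R).

HB.instance Definition _ (R : realType) := Measurable.on (angle R).

(* D_{r,l}, with the product sigma-algebra, i.e. the Borel one since all factors
   are second countable. *)
Notation Dspace R r l := (r.-tuple R * l.-tuple (angle R))%type.

Definition xcoord (R : realType) r l (j : 'I_r) (u : Dspace R r l) : R[i] :=
  (tnth u.1 j)%:C%C.

Definition expcoord (R : realType) r l (k : 'I_l) (u : Dspace R r l) : R[i] :=
  (cos (sval (tnth u.2 k)) +i* sin (sval (tnth u.2 k)))%C.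

Record SU_set (R : realType) (H : hilbertType R) (r l : nat) := SUSet {
  suS : 'I_r -> set (H * H) ;
  suU : 'I_l -> {linear H -> H} ;
  suS_selfadjoint : forall j, selfadjoint (suS j) ;
  suU_unitary : forall k, unitary hdot hdot (suU k) }.

Section SU_set.
Context (R : realType) (H : hilbertType R) (r l : nat).
Variable A : SU_set H r l.

(* In the last clause E and F are the spectral measures of the two self-adjoint
   operators; being unique, they may be quantified universally. *)
Definition SU_commuting : Prop :=
  [/\ forall k m x, suU A k (suU A m x) = suU A m (suU A k x),
      forall j k, ((graph (suU A k) \; suS A j) `<=` (suS A j \; graph (suU A k)))%relation
    & forall j k, j != k -> forall E F : spectral_measure H R,
        suS A j = spectral_integral E (fun t => t%:C%C) ->
        suS A k = spectral_integral F (fun t => t%:C%C) ->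
        forall a b, measurable a -> measurable b ->
        forall x, E a (F b x) = F b (E a x)].

Definition SU_Smon (m : 'I_r -> nat) : set (H * H) :=
  op_prod (fun j => op_pow (suS A j) (m j)).

Definition SU_Umon (n : 'I_l -> int) : set (H * H) :=
  op_prod (fun k => op_zpow (graph (suU A k)) (n k)).

Definition SU_generating (N : nat) (h : 'I_N -> H) : Prop :=
  (forall m i, op_dom (SU_Smon m) (h i)) /\
  closure (lin_span [set y | exists m n i,
     (SU_Umon n \; SU_Smon m)%relation (h i, y)]) = setT.

Definition SU_multiplicity (d : nat) : Prop :=
  (exists h : 'I_d -> H, SU_generating h) /\
  forall d', (d' < d)%N -> forall h : 'I_d' -> H, ~ SU_generating h.

Definition SU_spectral_measure (E : spectral_measure H (Dspace R r l)) : Prop :=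
  (forall j, suS A j = spectral_integral E (xcoord j)) /\
  (forall k, graph (suU A k) = spectral_integral E (expcoord k)).

End SU_set.

(* Main.v *)
Require Import Defs.
From HB Require Import structures.
From mathcomp Require Import all_boot all_order all_algebra.
From mathcomp Require Import sesquilinear complex.
From mathcomp Require Import all_classical all_reals all_analysis.
From mathcomp Require Import measurable_realfun.
From mathcomp Require Import ring lra.
Set Implicit Arguments.
Unset Strict Implicit.
Unset Printing Implicit Defensive.
Import Order.TTheory GRing.Theory Num.Theory.
Import numFieldNormedType.Exports.
Local Open Scope classical_set_scope.
Local Open Scope ring_scope.
(* The class of a simple function \sum_k 1_(A_k) u_k is sent to
   \sum_k E(A_k) (\sum_i (u_k)_i x_i). Since E(A) E(B) = E(A `&` B), this
   preserves norms, and simple functions are dense in L^2(M), so it extends to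
   an isometry V of L^2(M) into H. One has E(A) V f = V (1_A f), hence
   (E(.) V f, V f) has density f M' f^* with respect to tau_M; comparing
   L^2-distances to simple functions, (\int g dE) V f is defined exactly when
   g f lies in L^2(M), and then equals V (g f). This yields the intertwining
   relations, and shows that the range of V is invariant under the S_j, the U_k
   and the inverses of the U_k; it also contains the x_s = V e_s. So V is onto
   as soon as its range is closed, that is, as soon as L^2(M) is complete.
   Completeness is the matrix version of the Riesz-Fischer theorem: a measurable
   Gram-Schmidt projection modulo the null space of M'(t) turns a Cauchy
   sequence into one whose coordinates converge almost everywhere. *)

Local Notation Re := complex.Re.
Local Notation Im := complex.Im.

(** The norm of L^2(M) does not control the coordinates of a function: [mxderiv M t] may be
    singular, and its null space and smallest nonzero eigenvalue vary with [t] without any uniform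
    bound. Hence the projection is given by an explicit recursion, which keeps it measurable in [t],
    and the constant bounding its coordinates is used only at a fixed [t], after almost everywhere
    convergence has been prepared by a fast Cauchy sequence. [mxderiv M t] is positive only for
    almost every [t]. Wherever an integrand must be nonnegative at every point, the absolute value
    of the density [L2q] is integrated instead. Restriction to a set, and more generally
    multiplication by a function, acts on functions and not on classes; statements about such
    operations therefore carry representatives along. *)

Lemma quadratic_ge0_discr (R : realFieldType) (a b c : R) : 0 <= c ->
  (forall r, 0 <= a + 2 * r * b + r ^+ 2 * c) -> b ^+ 2 <= a * c.
Proof.
move=> c0 h; have [c1|c1] := eqVneq c 0.
  have [->|b0] := eqVneq b 0; first by rewrite c1 mulr0 expr0n.
  (* The expression is affine in [r] when [c = 0]; at this point it would equal [-1]. *)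
  have := h (- (a + 1) / (2 * b)); rewrite c1 mulr0 addr0.
  rewrite (_ : 2 * _ * b = - (a + 1)); last by field; rewrite b0.
  by move=> h1; exfalso; lra.
have {}c0 : 0 < c by rewrite lt_neqAle eq_sym c1.
(* The minimiser of the quadratic. *)
have := h (- b / c); rewrite (_ : _ + _ = (a * c - b ^+ 2) / c); last by field.
by rewrite pmulr_lge0 ?invr_gt0// subr_ge0.
Qed.

(** * Isometries on inner product spaces *)

Section dot_norm.
Context (R : realType) (U : lmodType R[i]) (f : {dot U for @Num.conj R[i]}).
Implicit Types u v w : U.

(** Real-valued scalar product and norm: L^2(M) carries only a form, and the norm of a Hilbert space
    lies in [R[i]]. For the latter, [normE] links the two. *)
Definition rdot u v : R := Re (f u v).
Definition dnrm u : R := Num.sqrt (rdot u u).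

Lemma form_dot_conj u v : f v u = (f u v)^*.
Proof. by rewrite hermC expr0 mul1r. Qed.

Lemma rdot_ge0 u : 0 <= rdot u u.
Proof. by have := dnorm_ge0 f u; rewrite /rdot; case: (f u u) => a b; rewrite lecE => /andP[]. Qed.

Lemma rdotC u v : rdot v u = rdot u v.
Proof. by rewrite /rdot form_dot_conj; case: (f u v). Qed.

Lemma rdotDl u v w : rdot (u + v) w = rdot u w + rdot v w.
Proof. by rewrite /rdot linearDl raddfD. Qed.

Lemma rdotDr u v w : rdot w (u + v) = rdot w u + rdot w v.
Proof. by rewrite rdotC rdotDl !(rdotC w). Qed.

Lemma rdotNl u w : rdot (- u) w = - rdot u w.
Proof. by rewrite /rdot linearNl raddfN. Qed.

Lemma rdotNr u w : rdot w (- u) = - rdot w u.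
Proof. by rewrite rdotC rdotNl rdotC. Qed.

Lemma rdotZl (r : R) u w : rdot (r%:C%C *: u) w = r * rdot u w.
Proof. by rewrite /rdot linearZl_LR/=; case: (f u w) => a b /=; rewrite mul0r subr0. Qed.

Lemma rdotZr (r : R) u w : rdot w (r%:C%C *: u) = r * rdot w u.
Proof. by rewrite rdotC rdotZl rdotC. Qed.

Lemma rdotZZ (c : R[i]) u : rdot (c *: u) (c *: u) = (Re c ^+ 2 + Im c ^+ 2) * rdot u u.
Proof.
rewrite /rdot linearZl_LR linearZr_LR/=.
by case: (f u u) c => a b [x y] /=; ring.
Qed.

(** Antilinearity in the second argument recovers the imaginary part, so identities between forms
    can be proved on real parts only. *)
Lemma form_dotE u v : f u v = (rdot u v +i* rdot u ('i%C *: v))%C.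
Proof. by rewrite /rdot linearZr_LR/=; case: (f u v) => a b /=; congr Complex; ring. Qed.

Lemma rdotD u v : rdot (u + v) (u + v) = rdot u u + 2 * rdot u v + rdot v v.
Proof. by rewrite !rdotDl !rdotDr (rdotC u v); ring. Qed.

Lemma rdot_CS u v : rdot u v ^+ 2 <= rdot u u * rdot v v.
Proof.
apply: quadratic_ge0_discr => [|r]; first exact: rdot_ge0.
have := rdot_ge0 (u + r%:C%C *: v).
by rewrite rdotD !(rdotZr, rdotZl) expr2 !mulrA.
Qed.

Lemma dnrm_ge0 u : 0 <= dnrm u.
Proof. exact: sqrtr_ge0. Qed.

Lemma sqr_dnrm u : dnrm u ^+ 2 = rdot u u.
Proof. by rewrite sqr_sqrtr// rdot_ge0. Qed.

Lemma rdot_le_dnrm u v : `|rdot u v| <= dnrm u * dnrm v.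
Proof.
rewrite -ler_sqr ?nnegrE// ?mulr_ge0 ?dnrm_ge0// exprMn !sqr_dnrm.
by rewrite real_normK ?num_real// rdot_CS.
Qed.

Lemma dnrmD u v : dnrm (u + v) <= dnrm u + dnrm v.
Proof.
rewrite -ler_sqr ?nnegrE ?addr_ge0 ?dnrm_ge0// sqr_dnrm rdotD sqrrD !sqr_dnrm.
rewrite lerD2r lerD2l -[leRHS]mulr_natl ler_pM2l//.
exact: le_trans (ler_norm _) (rdot_le_dnrm _ _).
Qed.

Lemma dnrmZ (c : R[i]) u : dnrm (c *: u) = Num.sqrt (Re c ^+ 2 + Im c ^+ 2) * dnrm u.
Proof. by rewrite /dnrm rdotZZ sqrtrM// addr_ge0// sqr_ge0. Qed.

Lemma dnrmN u : dnrm (- u) = dnrm u.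
Proof. by rewrite /dnrm rdotNl rdotNr opprK. Qed.

Lemma dnrmB u v : dnrm (u - v) = dnrm (v - u).
Proof. by rewrite -dnrmN opprB. Qed.

Lemma dnrm_tri v u w : dnrm (u - w) <= dnrm (u - v) + dnrm (v - w).
Proof. by rewrite -[u - w](subrKA v) dnrmD. Qed.

Lemma dnrm0_eq0 u : dnrm u = 0 -> u = 0.
Proof.
move=> /(congr1 (fun x => x ^+ 2)); rewrite sqr_dnrm expr0n/= => u0.
apply/eqP/negPn/negP => nu; have := dnorm_gt0 f u; rewrite nu.
by move: u0; rewrite /rdot; case: (f u u) => a b /= ->; rewrite ltcE/= ltxx andbF.
Qed.

Lemma dnrm_eps_eq0 u : (forall e, 0 < e -> dnrm u < e) -> u = 0.
Proof.
move=> h; apply: dnrm0_eq0; apply/eqP; rewrite eq_le dnrm_ge0 andbT.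
by apply/ler_addgt0Pr => e e0; rewrite add0r ltW// h.
Qed.

Lemma dnrm0 : dnrm 0 = 0.
Proof. by rewrite /dnrm /rdot linear0l sqrtr0. Qed.

Lemma dnrm_dist u v : `|dnrm u - dnrm v| <= dnrm (u - v).
Proof.
have h1 := dnrmD (u - v) v; have h2 := dnrmD (v - u) u.
rewrite !subrK dnrmB in h1 h2.
rewrite ler_norml; apply/andP; split; rewrite dnrmB; lra.
Qed.
End dot_norm.

Section hilbert_norm.
Context (R : realType) (H : hilbertType R).
Local Notation nm := (dnrm (@hdot R H)).

Lemma normE (x : H) : `|x| = (nm x)%:C%C.
Proof.
apply/eqP; rewrite -(@eqrXn2 _ 2)// ?lecR ?dnrm_ge0//.
rewrite -hdot_norm -rmorphXn /= sqr_dnrm form_dotE; apply/eqP; congr Complex.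
have := dnorm_ge0 (@hdot R H) x; rewrite form_dotE lecE => /andP[/eqP //].
Qed.

Lemma cvg_dnrmP (u : nat -> H) (y : H) : u @ \oo --> y <->
  (forall e, 0 < e -> \forall n \near \oo, nm (y - u n) < e).
Proof.
split=> [/cvgrPdist_lt h e e0|h].
  have e0' : 0 < e%:C%C :> R[i] by rewrite ltcR.
  by apply: filterS (h _ e0') => n; rewrite normE ltcR.
apply/cvgrPdist_lt => -[e e'] e0.
(* Positive elements of [R[i]] are real. *)
have [e1 e2] : 0 < e /\ e' = 0 by move: e0; rewrite ltcE/= => /andP[/eqP].
by rewrite e2; apply: filterS (h e e1) => n; rewrite normE ltcR.
Qed.
End hilbert_norm.

Section extension.
Context (R : realType) (K : lmodType R[i]) (dotK : {dot K for @Num.conj R[i]}).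
Context (H : hilbertType R).
Local Notation C := R[i].
Local Notation nK := (dnrm dotK).
Local Notation nH := (dnrm (@hdot R H)).

(** Real polarisation gives the real part; linearity at ['i *: y] gives the imaginary one. *)
Lemma isometry_dnrm (V : {linear K -> H}) :
  (forall x, nH (V x) = nK x) -> isometry hdot dotK V.
Proof.
move=> nV; have rV x y : rdot hdot (V x) (V y) = rdot dotK x y.
  have := congr1 (fun x => x ^+ 2) (nV (x + y)).
  rewrite /= !sqr_dnrm linearD !rdotD.
  have := congr1 (fun x => x ^+ 2) (nV x).
  have := congr1 (fun x => x ^+ 2) (nV y).
  by rewrite /= !sqr_dnrm => -> -> h; lra.
move=> x y; rewrite [LHS](form_dotE hdot) [RHS](form_dotE dotK) rV.
by congr Complex; rewrite -rV linearZ.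
Qed.

Lemma cauchy_cvg_dnrm (u : nat -> H) :
  (forall e, 0 < e -> exists n0, forall m n, (n0 <= m)%N -> (n0 <= n)%N ->
    nH (u m - u n) < e) -> exists y : H, u @ \oo --> y.
Proof.
move=> h; suff /cvg_ex[y uy] : cvg (u @ \oo) by exists y.
apply/cauchy_cvgP/cauchy_ballP => -[e e'] e0.
have [e1 e2] : 0 < e /\ e' = 0 by move: e0; rewrite ltcE/= => /andP[/eqP].
have [n0 hn] := h e e1.
pose B := u @` [set n | (n0 <= n)%N].
exists (B, B); first by split; exists n0 => // n /= n0n; exists n.
move=> [_ _] [/= [m n0m <-] [n n0n <-]]; rewrite -ball_normE /ball_/= e2 normE ltcR.
exact: hn.
Qed.

(** [V] is the closure [Gbar] of the relation [G]. Linearity and norm preservation make the closure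
    single-valued; density and the completeness of [H] make it total. *)
Lemma isometry_extension (G : set (K * H)) :
  (forall c p q, G p -> G q -> G (c *: p.1 + q.1, c *: p.2 + q.2)) ->
  (forall p, G p -> nH p.2 = nK p.1) ->
  (forall F e, 0 < e -> exists2 p, G p & nK (F - p.1) < e) ->
  exists V : {linear K -> H},
    (forall F, nH (V F) = nK F) /\ forall p, G p -> V p.1 = p.2.
Proof.
move=> Glin Giso Gdense.
have GB p q : G p -> G q -> nH (p.2 - q.2) = nK (p.1 - q.1).
  move=> Gp Gq; have := Giso _ (Glin (-1) _ _ Gq Gp) => /=.
  by rewrite !scaleN1r ![- _ + _]addrC.
pose Gbar F y := forall e, 0 < e -> exists2 p, G p & nK (F - p.1) < e /\ nH (y - p.2) < e.
have Gbarn F y : Gbar F y -> nH y = nK F.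
  move=> Fy; apply/eqP; rewrite -subr_eq0 -normr_le0; apply/ler_addgt0Pr => e e0.
  have [p Gp [p1 p2]] := Fy (e / 2) ltac:(by rewrite divr_gt0).
  rewrite add0r -(subrKA (nH p.2)) (le_trans (ler_normD _ _))//.
  rewrite [X in _ + `|X - _|]Giso// (distrC (nK _)).
  have := dnrm_dist (@hdot R H) y p.2; have := dnrm_dist dotK F p.1; lra.
have Gbarlin c F y F' y' : Gbar F y -> Gbar F' y' -> Gbar (c *: F + F') (c *: y + y').
  move=> Fy Fy' e e0; pose k := Num.sqrt (Re c ^+ 2 + Im c ^+ 2).
  have k0 : 0 <= k by exact: sqrtr_ge0.
  (* [k] is the modulus of [c]; the [+ 1] covers [c = 0]. *)
  have [p Gp [p1 p2]] := Fy (e / (2 * (k + 1))) ltac:(by rewrite divr_gt0// mulr_gt0// ltr_wpDl).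
  have [q Gq [q1 q2]] := Fy' (e / 2) ltac:(by rewrite divr_gt0).
  exists (c *: p.1 + q.1, c *: p.2 + q.2); first exact: Glin.
  have small a b : 0 <= a -> a < e / (2 * (k + 1)) -> b < e / 2 -> k * a + b < e.
    move=> a0 ae be; have : k * a <= (k + 1) * (e / (2 * (k + 1))).
      by apply: ler_pM => //; [rewrite lerDl|exact: ltW].
    have -> : (k + 1) * (e / (2 * (k + 1))) = e / 2 by field; lra.
    by lra.
  split => /=; rewrite opprD addrACA -scalerBr; apply: (le_lt_trans (dnrmD _ _ _));
    by rewrite dnrmZ; apply: small => //; exact: dnrm_ge0.
have Gbartot F : exists y, Gbar F y.
  have h n : exists p, G p /\ nK (F - p.1) < n.+1%:R^-1.
    by have [|p ? ?] := Gdense F n.+1%:R^-1; [rewrite invr_gt0|exists p].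
  have [p hp] := choice h.
  have [|y py] := @cauchy_cvg_dnrm (fun n => (p n).2).
    move=> e e0; have [n0 hn0] : exists n0, forall n, (n0 <= n)%N -> nK (F - (p n).1) < e / 2.
      have e20 : 0 < e / 2 by rewrite divr_gt0.
      have [n0 _ hn0] := near_infty_natSinv_lt (PosNum e20).
      by exists n0 => n n0n; apply: lt_trans (hp n).2 (hn0 _ n0n).
    exists n0 => m n m0 n_0; rewrite (GB _ _ (hp m).1 (hp n).1).
    apply: le_lt_trans (dnrm_tri _ F _ _) _; rewrite (dnrmB _ _ F).
    have := hn0 _ m0; have := hn0 _ n_0; lra.
  exists y => e e0.
  have [n1 _ hn1] := near_infty_natSinv_lt (PosNum e0).
  move/cvg_dnrmP : py => /(_ _ e0)[n2 _ hn2].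
  exists (p (maxn n1 n2)); first exact: (hp _).1.
  split; last by apply: hn2; rewrite /= leq_maxr.
  by apply: lt_trans (hp _).2 (hn1 _ _); rewrite /= leq_maxl.
have Gbaruniq F y y' : Gbar F y -> Gbar F y' -> y = y'.
  move=> Fy Fy'; apply/eqP; rewrite -subr_eq0; apply/eqP/(@dnrm0_eq0 _ _ (@hdot R H)).
  have := Gbarn _ _ (Gbarlin (-1) _ _ _ _ Fy' Fy).
  by rewrite !scaleN1r addrC => ->; rewrite addrC subrr dnrm0.
have [V0 V0E] := choice Gbartot.
have V0lin : linear V0.
  by move=> c F F'; apply: (Gbaruniq (c *: F + F')) => //; exact: Gbarlin.
pose V : {linear K -> H} := HB.pack V0 (GRing.isLinear.Build _ _ _ _ V0 V0lin).
exists V; split=> [F|p Gp]; first exact: Gbarn.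
apply: (Gbaruniq p.1) => // e e0; exists p => //.
by rewrite !subrr !dnrm0.
Qed.

End extension.

(** * Squared moduli and Cauchy-Schwarz for a positive matrix *)

Definition sqC (R : realType) (z : R[i]) : R := Re z ^+ 2 + Im z ^+ 2.

Section sqC.
Context (R : realType).
Implicit Types z w : R[i].

Lemma sqC_ge0 z : 0 <= sqC z.
Proof. by rewrite addr_ge0// sqr_ge0. Qed.

Lemma sqCM z w : sqC (z * w) = sqC z * sqC w.
Proof. by rewrite /sqC; case: z w => [a b] [c e] /=; ring. Qed.

Lemma sqCD z w : sqC (z + w) <= 2 * (sqC z + sqC w).
Proof.
rewrite /sqC; case: z w => [a b] [c e] /=; rewrite -subr_ge0.
have -> : 2 * (a ^+ 2 + b ^+ 2 + (c ^+ 2 + e ^+ 2)) - ((a + c) ^+ 2 + (b + e) ^+ 2)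
  = (a - c) ^+ 2 + (b - e) ^+ 2 by ring.
by rewrite addr_ge0// sqr_ge0.
Qed.

Lemma sqC_real (a : R) : sqC a%:C%C = a ^+ 2.
Proof. by rewrite /sqC /= expr0n/= addr0. Qed.
End sqC.

Section pos_form_CS.
Context (R : realType) (N : nat) (P : 'M[R[i]]_N) (P0 : pos_form P).

Lemma Re_mxform_CS u v :
  Re (mxform P u v) ^+ 2 <= Re (mxform P u u) * Re (mxform P v v).
Proof.
apply: quadratic_ge0_discr => [|r]; first exact: pos_form_Re.
have := pos_form_Re P0 (u + r%:C%C *: v).
rewrite !(mxformDl, mxformDr, mxformZl, mxformZr) (pos_formC P0 u v).
case: (mxform P u u) (mxform P v v) (mxform P u v) => [a b] [c e] [f g] /=.
by congr (_ <= _); ring.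
Qed.

(** The real and imaginary parts are bounded separately, whence the factor 2; only the finiteness of
    the constant matters later. *)
Lemma sqC_mxform_le u v :
  sqC (mxform P u v) <= 2 * (Re (mxform P u u) * Re (mxform P v v)).
Proof.
rewrite /sqC Im_mxform mulr2n mulrDl mul1r; apply: lerD; first exact: Re_mxform_CS.
apply: le_trans (Re_mxform_CS _ _) _.
rewrite mxformZr mxformZl; case: (mxform P v v) => a b /=.
by rewrite !(mul0r, mul1r, sub0r, add0r, opprK, oppr0, mulN1r, addr0, mulr1, mulr0).
Qed.

End pos_form_CS.

(** * Gram-Schmidt modulo a null space *)

Section gram_schmidt.
Context (R : realType) (N : nat).
Local Notation C := R[i].
Implicit Types (P Q : 'M[C]_N) (u v w b : 'rV[C]_N) (s : seq 'I_N).

(* u |-> <u,b>_P / <b,b>_P b, written with powR because the library knows that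
   powR is measurable; 0 `^ (-1) = 0, so null vectors b give 0. *)
Definition line_proj P b : 'M[C]_N :=
  (Re (mxform P b b) `^ (-1))%:C%C *: (P *m map_mx (@Num.conj C) b^T *m b).

Lemma mul_line_proj P b u : u *m line_proj P b =
  ((Re (mxform P b b) `^ (-1))%:C%C * mxform P u b) *: b.
Proof.
rewrite /line_proj -scalemxAr -scalerA; congr (_ *: _).
rewrite !mulmxA /mxform /form.
by apply/rowP => j; rewrite mxE big_ord1 [RHS]mxE.
Qed.

(* The P-orthogonal projection onto the span of the e_k, k \in s, up to vectors
   of P-norm 0. *)
Fixpoint gs_proj P s : 'M[C]_N :=
  if s is k :: s' then
    gs_proj P s' + line_proj P (delta_mx 0 k - delta_mx 0 k *m gs_proj P s')
  else 0.

Section pos.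
Context P (P0 : pos_form P).

Lemma line_projC b u v :
  mxform P (u *m line_proj P b) v = mxform P u (v *m line_proj P b).
Proof.
rewrite !mul_line_proj mxformZl mxformZr (pos_formC P0 b v).
set c := (_ `^ _)%:C%C; have cR z : (c * z)^* = c * z^*.
  rewrite /c; case: z => x y; apply/eqP; rewrite eq_complex/=.
  by apply/andP; split; apply/eqP; ring.
by rewrite cR conjCK; ring.
Qed.

Lemma mxformBl u v w : mxform P (u - v) w = mxform P u w - mxform P v w.
Proof. by rewrite mxformDl -scaleN1r mxformZl mulN1r. Qed.

Lemma mxformBr u v w : mxform P w (u - v) = mxform P w u - mxform P w v.
Proof. by rewrite mxformDr -scaleN1r mxformZr rmorphN rmorph1 mulN1r. Qed.

Lemma gs_projC s u v :
  mxform P (u *m gs_proj P s) v = mxform P u (v *m gs_proj P s).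
Proof.
elim: s u v => [|k s ih] u v /=.
  by rewrite !mulmx0 -[0]/(0 : 'rV_N) -(subrr u) mxformBl subrr -(subrr v) mxformBr subrr.
by rewrite !mulmxDr mxformDl mxformDr ih line_projC.
Qed.

(** The image of [gs_proj P s] lies in the span of the [delta_mx 0 k] with [k \in s]. *)
Lemma gs_proj_span s u w : (forall k, k \in s -> mxform P (delta_mx 0 k) w = 0) ->
  mxform P (u *m gs_proj P s) w = 0.
Proof.
elim: s u w => [|k s ih] u w h /=.
  by rewrite mulmx0 -(subrr u) mxformBl subrr.
have hs j : j \in s -> mxform P (delta_mx 0 j) w = 0.
  by move=> js; apply: h; rewrite in_cons js orbT.
rewrite mulmxDr mxformDl ih// add0r mul_line_proj mxformZl.
by rewrite [mxform P (_ - _) w]mxformBl ih// h ?mem_head// subr0 mulr0.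
Qed.

(** In the induction the new vector [b] is [P]-orthogonal to the earlier basis vectors, so adding
    its line does not disturb them; for the new index the line removes the remainder [b] itself, up
    to a [P]-null vector. *)
Lemma gs_proj_basis s k v : k \in s ->
  mxform P (delta_mx 0 k - delta_mx 0 k *m gs_proj P s) v = 0.
Proof.
elim: s k v => // j s ih k v /=; set b := delta_mx 0 j - _.
have orth i w : i \in s -> mxform P (delta_mx 0 i) (w - w *m gs_proj P s) = 0.
  by move=> /ih h; rewrite mxformBr -gs_projC -mxformBl h.
rewrite mulmxDr opprD addrA mxformBl mul_line_proj mxformZl.
rewrite in_cons => /orP[/eqP ->|ks]; last by rewrite ih// sub0r orth// mulr0 mul0r oppr0.
(* A [P]-null [b] makes both terms vanish; otherwise the coefficient of the line is exactly 1. *)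
have [b0|b0] := eqVneq (Re (mxform P b b)) 0.
  by rewrite !(pos_form_eq0 P0 _ b0) mulr0 subrr.
have -> : mxform P (delta_mx 0 j) b = mxform P b b.
  rewrite [in RHS]/b mxformBl gs_proj_span ?subr0// => i; exact: orth.
rewrite powR_inv1 ?pos_form_Re//.
have bb : mxform P b b = (Re (mxform P b b))%:C%C.
  by have := pos_form_Im P0 b; case: (mxform P b b) => x y /= ->.
by rewrite [X in _ * X * _]bb -rmorphM/= mulVf// mul1r subrr.
Qed.

(** The coordinates of [u] may be large although its [P]-norm vanishes. Those of the projection
    involve [u] only through its pairings with the vectors [b], to which Cauchy-Schwarz applies. *)
Lemma gs_proj_bound s : exists K, 0 <= K /\
  forall u j, sqC ((u *m gs_proj P s) 0 j) <= K * Re (mxform P u u).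
Proof.
elim: s => [|k s [K [K0 hK]]] /=.
  by exists 0; split => // u j; rewrite mulmx0 mxE sqC_real expr0n/= mul0r.
set b := delta_mx 0 k - _; set c := Re (mxform P b b) `^ (-1).
pose B := \sum_j sqC (b 0 j).
have B0 j : sqC (b 0 j) <= B.
  by rewrite /B (bigD1 j)//= lerDl sumr_ge0// => i _; exact: sqC_ge0.
have B1 : 0 <= B by apply: sumr_ge0 => i _; exact: sqC_ge0.
have bb0 := pos_form_Re P0 b.
(* The outer 2 comes from [sqCD], the inner one from [sqC_mxform_le]. *)
exists (2 * (K + c ^+ 2 * (2 * Re (mxform P b b)) * B)); split.
  by rewrite mulr_ge0// addr_ge0// !mulr_ge0 ?powR_ge0.
move=> u j; rewrite mulmxDr mxE (le_trans (sqCD _ _))// -[leRHS]mulrA.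
rewrite ler_pM2l//.
rewrite mulrDl lerD//; rewrite mul_line_proj -/c mxE !sqCM sqC_real.
have uu0 := pos_form_Re P0 u.
apply: (@le_trans _ _ (c ^+ 2 * (2 * (Re (mxform P u u) * Re (mxform P b b))) * B)).
  apply: ler_pM => //; rewrite ?mulr_ge0 ?powR_ge0 ?sqC_ge0//.
  by rewrite ler_wpM2l ?sqr_ge0// sqC_mxform_le.
by rewrite le_eqVlt; apply/orP; left; apply/eqP; ring.
Qed.

Lemma gs_projT u v : mxform P (u - u *m gs_proj P (enum 'I_N)) v = 0.
Proof.
set Q := gs_proj _ _.
have {1}-> : u - u *m Q = \sum_j u 0 j *: (delta_mx 0 j - delta_mx 0 j *m Q).
  rewrite {1 2}(row_sum_delta u) mulmx_suml -sumrB; apply: eq_bigr => j _.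
  by rewrite scalerBr scalemxAl.
elim/big_ind: _ => [|x y x0 y0|j _].
- by rewrite -(subrr u) mxformBl subrr.
- by rewrite mxformDl x0 y0 addr0.
- by rewrite mxformZl gs_proj_basis ?mulr0// mem_enum.
Qed.

End pos.

End gram_schmidt.

(** * Measurability of complex and matrix functions *)

Section complex_measurable.
Context d (T : measurableType d) (R : realType).
Local Notation C := R[i].

Definition cmeasurable (f : T -> C) :=
  measurable_fun setT (fun t => Re (f t)) /\ measurable_fun setT (fun t => Im (f t)).

Implicit Types f g : T -> C.

Lemma cmeasurable_cst c : cmeasurable (fun=> c).
Proof. by split; exact: measurable_cst. Qed.

Lemma cmeasurable_real (a : T -> R) :
  measurable_fun setT a -> cmeasurable (fun t => (a t)%:C%C).
Proof. by split => //; exact: measurable_cst. Qed.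

Lemma cmeasurableD f g : cmeasurable f -> cmeasurable g -> cmeasurable (fun t => f t + g t).
Proof.
by move=> [f1 f2] [g1 g2]; split; under eq_fun do rewrite raddfD /=;
  exact: measurable_funD.
Qed.

Lemma cmeasurableN f : cmeasurable f -> cmeasurable (fun t => - f t).
Proof.
by move=> [f1 f2]; split; under eq_fun do rewrite raddfN /=;
  exact: measurableT_comp.
Qed.

Lemma cmeasurableB f g : cmeasurable f -> cmeasurable g -> cmeasurable (fun t => f t - g t).
Proof. by move=> mf mg; apply: cmeasurableD mf (cmeasurableN mg). Qed.

Lemma cmeasurableM f g : cmeasurable f -> cmeasurable g -> cmeasurable (fun t => f t * g t).
Proof.
move=> [f1 f2] [g1 g2]; split.
- rewrite (_ : (fun _ => _) = fun t => Re (f t) * Re (g t) - Im (f t) * Im (g t)).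
    by apply: measurable_funB; apply: measurable_funM.
  by apply/funext => t; case: (f t) (g t) => [? ?] [].
- rewrite (_ : (fun _ => _) = fun t => Re (f t) * Im (g t) + Im (f t) * Re (g t)).
    by apply: measurable_funD; apply: measurable_funM.
  by apply/funext => t; case: (f t) (g t) => [? ?] [].
Qed.

Lemma cmeasurable_conj f : cmeasurable f -> cmeasurable (fun t => (f t)^*).
Proof.
move=> [f1 f2]; split.
- by rewrite (_ : (fun _ => _) = fun t => Re (f t))//; apply/funext => t; case: (f t).
- rewrite (_ : (fun _ => _) = fun t => - Im (f t)); first exact: measurableT_comp.
  by apply/funext => t; case: (f t).
Qed.

Lemma cmeasurable_sum (I : Type) (s : seq I) (f : I -> T -> C) :
  (forall i, cmeasurable (f i)) -> cmeasurable (fun t => \sum_(i <- s) f i t).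
Proof.
move=> mf; elim: s => [|i s ih].
  by under [X in cmeasurable X]eq_fun do rewrite big_nil; exact: cmeasurable_cst.
by under [X in cmeasurable X]eq_fun do rewrite big_cons; exact: cmeasurableD.
Qed.

Lemma cmeasurable_indic (A : set T) : measurable A -> cmeasurable (fun t => (\1_A t)%:C%C : C).
Proof. by move=> mA; apply: cmeasurable_real; exact: measurable_indic. Qed.

Lemma measurable_sqC f : cmeasurable f -> measurable_fun setT (fun t => sqC (f t)).
Proof.
by move=> [f1 f2]; apply: measurable_funD; apply: measurable_funX.
Qed.

Definition mxmeasurable p q (A : T -> 'M[C]_(p, q)) := forall i j, cmeasurable (fun t => A t i j).

Lemma mxmeasurable_cst p q (A : 'M[C]_(p, q)) : mxmeasurable (fun=> A).
Proof. by move=> i j; exact: cmeasurable_cst. Qed.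

Lemma mxmeasurableD p q (A B : T -> 'M[C]_(p, q)) :
  mxmeasurable A -> mxmeasurable B -> mxmeasurable (fun t => A t + B t).
Proof.
by move=> mA mB i j; under [X in cmeasurable X]eq_fun do rewrite mxE; exact: cmeasurableD.
Qed.

Lemma mxmeasurableN p q (A : T -> 'M[C]_(p, q)) :
  mxmeasurable A -> mxmeasurable (fun t => - A t).
Proof.
by move=> mA i j; under [X in cmeasurable X]eq_fun do rewrite mxE; exact: cmeasurableN.
Qed.

Lemma mxmeasurableM p q r (A : T -> 'M[C]_(p, q)) (B : T -> 'M[C]_(q, r)) :
  mxmeasurable A -> mxmeasurable B -> mxmeasurable (fun t => A t *m B t).
Proof.
move=> mA mB i j; under [X in cmeasurable X]eq_fun do rewrite mxE.
by apply: cmeasurable_sum => k; exact: cmeasurableM.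
Qed.

Lemma mxmeasurableZ p q (h : T -> C) (A : T -> 'M[C]_(p, q)) :
  cmeasurable h -> mxmeasurable A -> mxmeasurable (fun t => h t *: A t).
Proof.
by move=> mh mA i j; under [X in cmeasurable X]eq_fun do rewrite mxE; exact: cmeasurableM.
Qed.

Lemma mxmeasurable_adj p q (A : T -> 'M[C]_(p, q)) :
  mxmeasurable A -> mxmeasurable (fun t => map_mx (@Num.conj C) (A t)^T).
Proof.
move=> mA i j; under [X in cmeasurable X]eq_fun do rewrite !mxE.
exact: cmeasurable_conj.
Qed.

Lemma cmeasurable_mxform N (P : T -> 'M[C]_N) (u v : T -> 'rV[C]_N) :
  mxmeasurable P -> mxmeasurable u -> mxmeasurable v ->
  cmeasurable (fun t => mxform (P t) (u t) (v t)).
Proof.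
move=> mP mu mv.
exact: (mxmeasurableM (mxmeasurableM mu mP) (mxmeasurable_adj mv) 0 0).
Qed.

Lemma mxmeasurable_gs_proj N (P : T -> 'M[C]_N) (s : seq 'I_N) :
  mxmeasurable P -> mxmeasurable (fun t => gs_proj (P t) s).
Proof.
move=> mP; elim: s => [|k s ih] /=; first exact: mxmeasurable_cst.
apply: mxmeasurableD => //.
have mb : mxmeasurable (fun t => delta_mx 0 k - delta_mx 0 k *m gs_proj (P t) s : 'rV[C]_N).
  apply: mxmeasurableD; first exact: mxmeasurable_cst.
  by apply: mxmeasurableN; apply: mxmeasurableM => //; exact: mxmeasurable_cst.
apply: mxmeasurableZ.
  apply: cmeasurable_real.
  apply: (@measurableT_comp _ _ _ _ _ _ (fun y : R => y `^ (-1))); first exact: measurable_powR.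
  by have [] := cmeasurable_mxform mP mb mb.
by apply: mxmeasurableM => //; apply: mxmeasurableM => //; exact: mxmeasurable_adj.
Qed.

Lemma mxmeasurable_rV N (f : T -> 'rV[C]_N) : mxmeasurable f <-> measurable_rV f.
Proof. by split=> [h j|h i j]; [exact: h|rewrite ord1; exact: h]. Qed.

End complex_measurable.

(** * Norms in L^2(M) as integrals *)

Section L2_facts.
Context d (T : measurableType d) (R : realType) (N : nat).
Variable M : mxmeasure T R N.
Local Notation C := R[i].
Local Notation tau := (trace_measure M).
Local Notation nm := (dnrm (L2dot M)).
Implicit Types f g : T -> 'rV[C]_N.

Definition L2q f t : R := Re (L2form M f f t).

Lemma rdot_L2class (f g : L2fun M) : rdot (L2dot M) (L2class f) (L2class g) =
  \int[tau]_t (Re (L2form M f g t)).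
Proof. exact: (congr1 (@complex.Re R) (L2dotE f g)). Qed.

Lemma nsq_L2class (f : L2fun M) :
  ((nm (L2class f) ^+ 2)%:E = \int[tau]_t (L2q f t)%:E)%E.
Proof.
rewrite sqr_dnrm rdot_L2class /Rintegral fineK//.
exact: integrable_fin_num (L2fun_integrable (L2funP f)).
Qed.

(** The density is nonnegative only almost everywhere; its absolute value can be fed to Fatou's
    lemma and to pointwise comparison of integrals. *)
Lemma integral_abs_L2q f : measurable_rV f ->
  (\int[tau]_t (`|L2q f t|)%:E = \int[tau]_t (L2q f t)%:E)%E.
Proof.
move=> mf; apply: ae_eq_integral => //.
- by apply/measurable_EFinP/measurableT_comp => //; exact: measurable_L2form.
- by apply/measurable_EFinP; exact: measurable_L2form.
- by apply: filterS (ae_L2form_ge0 M f) => t h _; rewrite ger0_norm.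
Qed.

Lemma measurable_L2q f : measurable_rV f -> measurable_fun setT (L2q f).
Proof. by move=> mf; exact: measurable_L2form. Qed.

Lemma dnrm_L2class_le (f g : L2fun M) :
  (forall t, `|L2q f t| <= `|L2q g t|) -> nm (L2class f) <= nm (L2class g).
Proof.
move=> fg; have mf := (L2funP f).1; have mg := (L2funP g).1.
have sqr_le (a b : R) (I J : \bar R) : 0 <= a -> 0 <= b ->
    (a ^+ 2)%:E = I -> (b ^+ 2)%:E = J -> (I <= J)%E -> a <= b.
  by move=> a0 b0 <- <-; rewrite lee_fin ler_sqr.
apply: (sqr_le _ _ _ _ (dnrm_ge0 _ _) (dnrm_ge0 _ _)
  (etrans (nsq_L2class f) (esym (integral_abs_L2q mf)))
  (etrans (nsq_L2class g) (esym (integral_abs_L2q mg)))).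
apply: ge0_le_integral => //.
- by apply/measurable_EFinP/measurableT_comp => //; exact: measurable_L2q.
- by apply/measurable_EFinP/measurableT_comp => //; exact: measurable_L2q.
- by move=> t _; rewrite lee_fin.
Qed.

Lemma mxmeasurable_mxderiv : mxmeasurable (mxderiv M).
Proof. by move=> i j; split; [exact: measurable_Re_mxderiv|exact: measurable_Im_mxderiv]. Qed.

Lemma L2fun_exists f : L2fun_set M f -> exists F : L2fun M, F = f :> (T -> _).
Proof. by move=> lf; exists (MkL2fun (mem_set lf)). Qed.

Lemma L2q_mul (h : T -> C) f t : L2q (fun t => h t *: f t) t = sqC (h t) * L2q f t.
Proof.
rewrite /L2q /L2form mxformZl mxformZr /sqC.
by case: (h t) (mxform _ _ _) => [a b] [c e] /=; ring.
Qed.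
End L2_facts.

Lemma cvg_Re_mxform (R : realType) (N : nat) (P : 'M[R[i]]_N) (u : nat -> 'rV[R[i]]_N)
    (v : 'rV[R[i]]_N) :
  (forall j, (fun n => Re (u n 0 j)) @ \oo --> Re (v 0 j)) ->
  (forall j, (fun n => Im (u n 0 j)) @ \oo --> Im (v 0 j)) ->
  (fun n => Re (mxform P (u n) (u n))) @ \oo --> Re (mxform P v v).
Proof.
move=> hr hi; under eq_fun do rewrite Re_mxform.
rewrite Re_mxform; apply: cvg_bigsum => j; apply: cvg_bigsum => k.
apply: cvgB; apply: cvgM; [|exact: cvg_cst| |exact: cvg_cst].
- by apply: cvgD; apply: cvgM.
- by apply: cvgB; apply: cvgM.
Qed.

(** The increments are at most [Num.sqrt C * 2^-1 ^+ n], so the telescoping series converges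
    absolutely. *)
Lemma is_cvg_geometric_increments (R : realType) (b : nat -> R) (C : R) :
  (forall n, (b n.+1 - b n) ^+ 2 <= C * 4^-1 ^+ n) -> cvgn b.
Proof.
move=> h; have C0 : 0 <= C.
  by have := h 0%N; rewrite expr0 mulr1; apply: le_trans; exact: sqr_ge0.
pose u n := b n.+1 - b n.
suff : cvgn (series u).
  move=> su; have -> : b = (fun n => b 0%N + series u n).
    apply/funext => n; rewrite /series/= /u telescope_sumr//; first by rewrite addrC subrK.
  by apply: is_cvgD su; exact: is_cvg_cst.
apply: normed_cvg; apply: (@series_le_cvg _ _ (geometric (Num.sqrt C) 2^-1)) => [n|n|n|].
- exact: normr_ge0.
- by apply: geometric_ge0 => //; rewrite ?sqrtr_ge0 ?invr_ge0.
- rewrite /= -ler_sqr ?nnegrE ?mulr_ge0 ?sqrtr_ge0 ?exprn_ge0 ?invr_ge0//.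
  rewrite real_normK ?num_real// exprMn sqr_sqrtr// -exprM mulnC exprM.
  by rewrite (_ : 2^-1 ^+ 2 = 4^-1)//; first exact: h; rewrite exprVn -natrX.
- by apply: is_cvg_geometric_series; rewrite ger0_norm ?invr_ge0// invf_lt1 ?ltr1n.
Qed.

Lemma fine_limn_esup (R : realType) (b : nat -> R) (l : R) : b @ \oo --> l ->
  fine (limn_esup (fun n => (b n)%:E)) = l.
Proof.
move=> bl; have h : (fun n => (b n)%:E) @ \oo --> l%:E.
  by apply: cvg_EFin => //; exact: nearW.
by rewrite (cvg_limn_einf_sup h).2.
Qed.

Lemma limn_einf_le_near (R : realType) (u : (\bar R)^nat) (c : \bar R) (m : nat) :
  (forall n, (m <= n)%N -> (u n <= c)%E) -> (limn_einf u <= c)%E.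
Proof.
move=> uc; rewrite limn_einf_lim; apply: lime_le; first exact: is_cvg_einfs.
exists m => // n /= mn; apply: le_trans (uc n mn).
by apply: ereal_inf_lbound; exists n => //=.
Qed.

(** * Completeness of the matrix L2 space *)

Section L2_complete.
Context d (T : measurableType d) (R : realType) (N : nat).
Variable M : mxmeasure T R N.
Local Notation C := R[i].
Local Notation tau := (trace_measure M).
Local Notation nm := (dnrm (L2dot M)).
Local Notation P := (mxderiv M).
Local Notation pr t := (gs_proj (P t) (enum 'I_N)).

Section fast.
Variables (f : nat -> L2fun M).
Hypothesis f_fast : forall n, nm (L2class (f n.+1) - L2class (f n)) <= 4^-1 ^+ n.

(** For almost every [t] this differs from [f n t] by a [P t]-null vector ([gs_projT]), while the
    form controls its coordinates. *)
Let fQ n t : 'rV[C]_N := f n t *m pr t.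

Let mfQ n : mxmeasurable (fQ n).
Proof.
apply: mxmeasurableM; first exact/mxmeasurable_rV/(L2funP (f n)).1.
exact/mxmeasurable_gs_proj/mxmeasurable_mxderiv.
Qed.

(** The squared norms are at most [16 ^- n]; weighted by [4 ^+ n] they stay summable. The weighted
    sum is therefore integrable, and [K] is its value at [t], finite almost everywhere. *)
Let ae_fast : {ae tau, forall t, exists K, forall n,
  L2q M (f n.+1 - f n) t <= K * 4^-1 ^+ n}.
Proof.
pose a n t := ((4 ^+ n)%:E * (`|L2q M (f n.+1 - f n) t|)%:E)%E.
have ml n : measurable_fun setT (fun t => (`|L2q M (f n.+1 - f n) t|)%:E).
  apply/measurable_EFinP/measurableT_comp => //.
  by apply: measurable_L2form; exact: (L2funP (f n.+1 - f n)).1.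
have ma n : measurable_fun setT (a n) by apply: measurable_funeM.
have a0 n t : (0 <= a n t)%E by apply: mule_ge0; rewrite lee_fin ?exprn_ge0.
have ia n : (\int[tau]_t a n t <= (4^-1 ^+ n)%:E)%E.
  rewrite ge0_integralZl//.
  rewrite integral_abs_L2q; last exact: (L2funP (f n.+1 - f n)).1.
  rewrite -(nsq_L2class (f n.+1 - f n)) -EFinM lee_fin L2classD L2classN.
  have : nm (L2class (f n.+1) - L2class (f n)) ^+ 2 <= (4^-1 ^+ n) ^+ 2.
    by rewrite ler_sqr ?nnegrE ?dnrm_ge0 ?exprn_ge0 ?invr_ge0.
  move=> /(ler_wpM2l (exprn_ge0 n (ler0n R 4))) /le_trans; apply.
  by rewrite expr2 mulrA -exprMn divff// expr1n mul1r.
have isum : tau.-integrable setT (fun t => \sum_(n <oo) a n t)%E.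
  apply/integrableP; split.
    apply: (@ge0_emeasurable_sum _ _ _ _ _ xpredT) => // n t _ _; exact: a0.
  rewrite (_ : (\int[_]_(_ in _) _ = \sum_(n <oo) \int[tau]_t a n t)%E); last first.
    rewrite -integral_nneseries//.
    congr (integral _ _ _); apply/funext => t.
    by rewrite gee0_abs// nneseries_ge0.
  apply: (@le_lt_trans _ _ (\sum_(n <oo) (4^-1 ^+ n)%:E)%E).
    apply: lee_nneseries => // n _ _; exact: integral_ge0.
  have h := @is_cvg_geometric_series R 1 4^-1.
  rewrite (_ : (fun n => _) = EFin \o series (geometric 1 4^-1)).
    rewrite EFin_lim ?ltry//; apply: h.
    by rewrite ger0_norm ?invr_ge0// invf_lt1 ?ltr1n.
  apply/funext => n; rewrite /= sumEFin; congr EFin.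
  by apply: eq_bigr => k _; rewrite /= mul1r.
have := integrable_ae measurableT isum; apply: filterS => t /(_ I) fin.
exists (fine (\sum_(n <oo) a n t)%E) => n.
rewrite exprVn ler_pdivlMr ?exprn_gt0// -lee_fin fineK//.
apply: (@le_trans _ _ (a n t)).
  by rewrite /a -EFinM lee_fin mulrC ler_pM2l ?exprn_gt0// ler_norm.
rewrite (@nneseriesD1 _ _ n)//.
by rewrite leeDl// nneseries_ge0.
Qed.

(** A limsup is measurable whether or not the sequence converges at [t]; [fine] gives 0 where it is
    infinite. *)
Let g t : 'rV[C]_N := \row_j
  (fine (limn_esup (fun n => (Re (fQ n t 0 j))%:E)) +i*
   fine (limn_esup (fun n => (Im (fQ n t 0 j))%:E)))%C.

Let mg : measurable_rV g.
Proof.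
move=> j; split; under eq_fun do rewrite mxE /=;
  apply: (@measurableT_comp _ _ _ _ _ _ (@fine R)) => //;
  apply: measurable_fun_limn_esup => n; apply/measurable_EFinP.
- by have [] := mfQ n 0 j.
- by have [] := mfQ n 0 j.
Qed.

(** By [ae_fast] and [gs_proj_bound] the coordinates of [fQ n t] have geometrically small
    increments, hence converge to those of [g t]. *)
Let ae_cvg m : {ae tau, forall t,
  (fun n => L2q M (f m - f n) t) @ \oo --> L2q M ((f m : T -> 'rV[C]_N) - g) t}.
Proof.
near=> t.
have P0 : pos_form (P t) by near: t; exact: ae_pos_form.
have [K hK] : exists K, forall n, L2q M (f n.+1 - f n) t <= K * 4^-1 ^+ n by near: t.
have [B [B0 hB]] := gs_proj_bound P0 (enum 'I_N).
have inc n j : sqC (fQ n.+1 t 0 j - fQ n t 0 j) <= B * K * 4^-1 ^+ n.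
  rewrite (_ : _ - _ = ((f n.+1 t - f n t) *m pr t) 0 j); last first.
    by rewrite mulmxBl !mxE.
  by apply: le_trans (hB _ _) _; rewrite -mulrA ler_wpM2l//; exact: hK.
have cvr j : (fun n => Re (fQ n t 0 j)) @ \oo --> Re (g t 0 j).
  have /cvg_ex[l hl] : cvgn (fun n => Re (fQ n t 0 j)).
    apply: (@is_cvg_geometric_increments _ _ (B * K)) => n.
    apply: le_trans (inc n j); rewrite -raddfB /sqC.
    by rewrite lerDl sqr_ge0.
  by rewrite [g t 0 j]mxE/= (fine_limn_esup hl).
have cvi j : (fun n => Im (fQ n t 0 j)) @ \oo --> Im (g t 0 j).
  have /cvg_ex[l hl] : cvgn (fun n => Im (fQ n t 0 j)).
    apply: (@is_cvg_geometric_increments _ _ (B * K)) => n.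
    apply: le_trans (inc n j); rewrite -raddfB /sqC.
    by rewrite lerDr sqr_ge0.
  by rewrite [g t 0 j]mxE/= (fine_limn_esup hl).
rewrite (_ : (fun n => _) = fun n => Re (mxform (P t) (f m t - fQ n t) (f m t - fQ n t))).
  have eR (u v : 'rV[C]_N) j : Re ((u - v) 0 j) = Re (u 0 j) - Re (v 0 j).
    by rewrite !mxE raddfB.
  have eI (u v : 'rV[C]_N) j : Im ((u - v) 0 j) = Im (u 0 j) - Im (v 0 j).
    by rewrite !mxE raddfB.
  apply: cvg_Re_mxform => j.
    by under eq_fun do rewrite eR; rewrite eR; apply: cvgB => //; exact: cvg_cst.
  by under eq_fun do rewrite eI; rewrite eI; apply: cvgB => //; exact: cvg_cst.
apply/funext => n; rewrite /L2q /L2form.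
(* The second summand is [P t]-null, so replacing [f n t] by [fQ n t] does not change the form. *)
have -> : (f m - f n) t = (f m t - fQ n t) + (fQ n t - f n t).
  by rewrite subrKA.
set u := f m t - _; set w := _ - f n t.
have e0 v : mxform (P t) w v = 0.
  by rewrite /w -opprB -scaleN1r mxformZl gs_projT// mulr0.
by rewrite mxformDl e0 addr0 mxformDr (pos_formC P0 w u) e0 conjC0 addr0.
Unshelve. all: by end_near.
Qed.

(** The geometric sum would allow the constant 4/3; the subtracted term is what lets the induction
    on [k] close. *)
Let nm_fast m k : nm (L2class (f (m + k)%N) - L2class (f m)) <=
  2 * (4^-1 ^+ m - 4^-1 ^+ (m + k)).
Proof.
have aux (a b p q : R) : a <= p -> b <= 2 * (q - p) -> 0 <= p ->
  a + b <= 2 * (q - 4^-1 * p) by lra.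
elim: k => [|k ih]; first by rewrite addn0 !subrr dnrm0 mulr0.
rewrite addnS; apply: le_trans (dnrm_tri _ (L2class (f (m + k)%N)) _ _) _.
by rewrite exprS; apply: aux => //; exact: f_fast.
Qed.

Let nm_fast_le m n : (m <= n)%N ->
  nm (L2class (f m) - L2class (f n)) <= 2 * 4^-1 ^+ m.
Proof.
move=> mn; rewrite dnrmB -(subnKC mn); apply: le_trans (nm_fast _ _) _.
by rewrite ler_pM2l// gerBl exprn_ge0// invr_ge0.
Qed.

(** Fatou's lemma in [n] with [m] fixed: the terms with [n >= m] are bounded by [nm_fast_le]. *)
Let integral_fast m :
  (\int[tau]_t (L2q M ((f m : T -> 'rV[C]_N) - g) t)%:E <= ((2 * 4^-1 ^+ m) ^+ 2)%:E)%E.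
Proof.
have mfm n : measurable_rV (f m - f n) by exact: (L2funP (f m - f n)).1.
have mfg : measurable_rV ((f m : T -> 'rV[C]_N) - g).
  apply: measurable_rVD; first exact: (L2funP (f m)).1.
  by apply/mxmeasurable_rV/mxmeasurableN/mxmeasurable_rV.
have ml h : measurable_rV h -> measurable_fun setT (fun t => (`|L2q M h t|)%:E).
  by move=> mh; apply/measurable_EFinP/measurableT_comp => //; exact: measurable_L2form.
rewrite -integral_abs_L2q//.
apply: (@le_trans _ _
    (\int[tau]_t limn_einf (fun n => (`|L2q M (f m - f n) t|)%:E))%E).
  rewrite le_eqVlt; apply/orP; left; apply/eqP; apply: ae_eq_integral => //.
  - exact: ml.
  - under eq_fun do rewrite -[limn_einf _]oppeK -limn_esupN.
    apply: (@measurableT_comp _ _ _ _ _ _ (@oppe R)) => //.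
    by apply: measurable_fun_limn_esup => n; apply: measurableT_comp => //; exact: ml.
  - apply: filterS (ae_cvg m) => t h _.
    have {}h : (fun n => (`|L2q M (f m - f n) t|)%:E) @ \oo -->
        (`|L2q M ((f m : T -> 'rV[C]_N) - g) t|)%:E.
      by apply: cvg_EFin; [exact: nearW|exact: cvg_norm].
    by rewrite (cvg_limn_einf_sup h).1.
apply: le_trans (fatou _ _ _ _) _ => //; first by move=> n; exact: ml.
apply: (@limn_einf_le_near _ _ _ m) => n mn.
rewrite integral_abs_L2q// -(nsq_L2class (f m - f n)) L2classD L2classN lee_fin.
by rewrite ler_sqr ?nnegrE ?dnrm_ge0 ?mulr_ge0 ?exprn_ge0 ?invr_ge0// nm_fast_le.
Qed.

Lemma L2_fast_cauchy : exists G : L2 M, forall m,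
  nm (L2class (f m) - G) <= 2 * 4^-1 ^+ m.
Proof.
have lfg m : L2fun_set M ((f m : T -> 'rV[C]_N) - g).
  split; last exact: le_lt_trans (integral_fast m) (ltry _).
  apply: measurable_rVD; first exact: (L2funP (f m)).1.
  by apply/mxmeasurable_rV/mxmeasurableN/mxmeasurable_rV.
(* Only the differences [f m - g] are known to be square integrable, so [g] is recovered as
   [f 0 - (f 0 - g)]. *)
have [h hE] := L2fun_exists (lfg 0%N).
exists (L2class (f 0%N - h)) => m.
rewrite -ler_sqr ?nnegrE ?dnrm_ge0 ?mulr_ge0 ?exprn_ge0 ?invr_ge0//.
rewrite -L2classN -L2classD -lee_fin nsq_L2class.
apply: le_trans (integral_fast m); rewrite le_eqVlt; apply/orP; left; apply/eqP.
apply: eq_integral => t _; congr (L2q M _ t)%:E.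
have -> : (f m - (f 0%N - h) : L2fun M) = 
    (f m : T -> 'rV[C]_N) - ((f 0%N : T -> 'rV[C]_N) - (h : T -> 'rV[C]_N)) :> (T -> _) by [].
by rewrite hE subKr.
Qed.

End fast.
End L2_complete.

(** * Approximation by simple functions *)

Section simple_approximation.
Context d (T : measurableType d) (R : realType).
Local Notation C := R[i].

Definition fin_simple_fun (I : finType) (v : I -> C) (B : I -> set T)
    (mB : forall i, measurable (B i)) : simple_fun R T :=
  SimpleFun (fun i : 'I_#|I| => v (enum_val i)) (fun i => mB (enum_val i)).

Lemma fin_simple_funE (I : finType) (v : I -> C) (B : I -> set T)
    (mB : forall i, measurable (B i)) t :
  sf_eval (fin_simple_fun v mB) t = \sum_i v i * (\1_(B i) t)%:C%C.
Proof. by rewrite /sf_eval/= [RHS](big_enum_val (fun i => v i * (\1_(B i) t)%:C%C)). Qed.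

Lemma cmeasurable_sf_eval (s : simple_fun R T) : cmeasurable (sf_eval s).
Proof.
apply: cmeasurable_sum => i; apply: cmeasurableM; first exact: cmeasurable_cst.
by apply: cmeasurable_indic; exact: sf_meas.
Qed.

(** Half-open cells of length [e] starting at [- K]; the strict inequality [2 * K < n%:R * e] leaves
    room for [a = K]. The boolean equality also records that only one cell contains [a]. *)
Lemma grid_index (K e a : R) (n : nat) : 0 < e -> 0 <= K -> 2 * K < n%:R * e ->
  `|a| <= K -> exists i : 'I_n, forall j : 'I_n,
  (j%:R * e - K <= a < j.+1%:R * e - K) = (j == i).
Proof.
move=> e0 K0 nK; rewrite ler_norml => /andP[Ka aK].
pose b := (a + K) / e; have b0 : 0 <= b by rewrite divr_ge0 ?(ltW e0)//; lra.
have bE j : (j%:R * e - K <= a < j.+1%:R * e - K) = (j == Num.truncn b).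
  rewrite eq_sym truncn_eq// lerBlDr ltrBrDr /b.
  by rewrite ler_pdivlMr// ltr_pdivrMr.
have bn : (Num.truncn b < n)%N.
  rewrite truncn_lt_nat// /b ltr_pdivrMr//; lra.
by exists (Ordinal bn) => j; rewrite bE.
Qed.

(** The square of half-side [K] is cut into square cells, and the simple function takes on the
    preimage of each, within [A], the value of its lower left corner. *)
Lemma simple_fun_approx (g : T -> C) (A : set T) (K e : R) :
  cmeasurable g -> measurable A -> 0 <= K ->
  (forall t, A t -> sqC (g t) <= K ^+ 2) -> 0 < e ->
  exists s : simple_fun R T,
    forall t, (A t -> sqC (sf_eval s t - g t) <= e) /\ (~ A t -> sf_eval s t = 0).
Proof.
move=> [mg1 mg2] mA K0 gK e0.
(* [c] is the side of a cell: an error of at most [c] in each part amounts to [e] for the squared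
   modulus. *)
have [c c0 ce] : exists2 c : R, 0 < c & c ^+ 2 + c ^+ 2 = e.
  exists (Num.sqrt (e / 2)); first by rewrite sqrtr_gt0 divr_gt0.
  by rewrite sqr_sqrtr ?divr_ge0 ?(ltW e0)//; lra.
pose n := (Num.truncn (2 * K / c)).+1.
have nK : 2 * K < n%:R * c.
  by rewrite -ltr_pdivrMr// truncnS_gt.
pose cell (a : T -> R) (i : 'I_n) := [set t | i%:R * c - K <= a t < i.+1%:R * c - K].
have mcell a i : measurable_fun setT a -> measurable (cell a i).
  move=> ma; rewrite (_ : cell a i = setT `&` a @^-1` `[i%:R * c - K, i.+1%:R * c - K[%classic).
    by apply: ma.
  by rewrite setTI; apply/seteqP; split => t; rewrite /cell /= in_itv.
pose B (p : 'I_n * 'I_n) := A `&`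
  (cell (fun t => Re (g t)) p.1 `&` cell (fun t => Im (g t)) p.2).
have mB p : measurable (B p).
  by apply: measurableI => //; apply: measurableI; exact: mcell.
pose v (p : 'I_n * 'I_n) : C := ((p.1%:R * c - K) +i* (p.2%:R * c - K))%C.
exists (fin_simple_fun v mB) => t; split=> At; rewrite fin_simple_funE; last first.
  by apply: big1 => p _; rewrite indicE memNset ?mulr0// => -[].
have hRe : `|Re (g t)| <= K.
  rewrite -ler_sqr ?nnegrE// real_normK ?num_real//.
  by apply: le_trans (gK _ At); rewrite /sqC lerDl sqr_ge0.
have hIm : `|Im (g t)| <= K.
  rewrite -ler_sqr ?nnegrE// real_normK ?num_real//.
  by apply: le_trans (gK _ At); rewrite /sqC lerDr sqr_ge0.
have [i hi] := grid_index c0 K0 nK hRe.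
have [j hj] := grid_index c0 K0 nK hIm.
have BE p : (\1_(B p) t : R) = (p == (i, j))%:R.
  rewrite indicE; congr (nat_of_bool _)%:R; case: p => k l; rewrite xpair_eqE -hi -hj.
  apply/idP/idP => [/set_mem[_ [/= -> ->]]//|/andP[h1 h2]].
  by apply/mem_set; split => //; split.
rewrite (bigD1 (i, j))//= big1; last by move=> p /negbTE pij; rewrite BE pij mulr0.
rewrite BE eqxx mulr1 addr0 /sqC /v.
have := hi i; rewrite eqxx => /andP[]; have := hj j; rewrite eqxx => /andP[].
case: (g t) => x y /=; rewrite -!natr1 !mulrDl !mul1r => y1 y2 x1 x2.
rewrite -ce lerD//; rewrite -real_normK ?num_real// ler_sqr ?nnegrE ?(ltW c0)// ler_norml;
  apply/andP; split; lra.
Qed.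
End simple_approximation.

(** Dominated convergence for truncated approximations: [A n] is the region where the [n]-th one is
    accurate, every point lies in [A n] eventually, and elsewhere [W] bounds the error. *)
Lemma dominated_approx d (T : measurableType d) (R : realType)
    (mu : {measure set T -> \bar R}) (F : nat -> T -> R) (W : T -> R) (A : nat -> set T) :
  (forall n, measurable_fun setT (F n)) ->
  mu.-integrable setT (EFin \o W) ->
  (forall t, exists m, forall n, (m <= n)%N -> A n t) ->
  {ae mu, forall t n, `|F n t| <= W t /\ (A n t -> `|F n t| <= n.+1%:R^-1 * W t)} ->
  (fun n => \int[mu]_t (F n t)%:E)%E @ \oo --> 0%E.
Proof.
move=> mF iW hA hF.
have [|||||_ _] := @dominated_convergence _ _ _ mu setT measurableT
    (fun n t => (F n t)%:E) (cst 0%E) (EFin \o W).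
- by move=> n; exact/measurable_EFinP.
- exact: measurable_cst.
- apply: filterS hF => t ht _; apply: cvg_EFin; first exact: nearW.
  have [m hm] := hA t.
  apply/norm_cvg0P.
  apply: (@squeeze_cvgr _ _ _ _ (cst 0) (fun n => n.+1%:R^-1 * W t)).
  + exists m => // n /= mn; rewrite normr_ge0/=; exact: (ht n).2 (hm n mn).
  + exact: cvg_cst.
  + rewrite -(mul0r (W t)); apply: cvgMl; exact: cvg_harmonic.
- exact: iW.
- by apply: filterS hF => t ht n _; rewrite lee_fin; exact: (ht n).1.
- by rewrite integral0.
Qed.

(** * Bounded multipliers and an integrable majorant *)

Section L2_mult.
Context d (T : measurableType d) (R : realType) (N : nat).
Variable M : mxmeasure T R N.
Local Notation C := R[i].
Local Notation tau := (trace_measure M).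
Local Notation nm := (dnrm (L2dot M)).

Lemma L2fun_setM (h : T -> C) (K : R) f : cmeasurable h -> (forall t, sqC (h t) <= K) ->
  L2fun_set M f -> L2fun_set M (fun t => h t *: f t).
Proof.
move=> mh hK lf; have mhf : measurable_rV (fun t => h t *: f t).
  by apply: measurable_rVZ => //; [exact: mh.1|exact: mh.2|exact: lf.1].
split => //; apply: integrable_lty => //.
apply: (@ae_integrable_le _ _ _ _ _ _ (fun t => K * L2q M f t)).
- exact: measurable_L2form.
- exact: (integrableZl measurableT K (L2fun_integrable lf)).
- apply: filterS (ae_pos_form M) => t P0.
  rewrite ger0_norm; last exact: pos_form_Re.
  by rewrite -/(L2q M _ t) L2q_mul ler_wpM2r//; exact: pos_form_Re.
Qed.

(** An integrable majorant of the form on rows with entries of modulus at most 1; it turns uniform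
    approximation of coordinates into approximation in L^2(M). *)
Definition entry_bound (t : T) : R :=
  \sum_j \sum_k (`|Re (mxderiv M t k j)| + `|Im (mxderiv M t k j)|).

Lemma integrable_entry_bound : tau.-integrable setT (EFin \o entry_bound).
Proof.
rewrite (_ : _ \o _ = fun t => (\sum_j \sum_k
    ((`|Re (mxderiv M t k j)|)%:E + (`|Im (mxderiv M t k j)|)%:E))%E); last first.
  by apply/funext => t /=; rewrite -sumEFin; apply: eq_bigr => j _; rewrite -sumEFin.
apply: (integrable_sum measurableT) => j _; apply: (integrable_sum measurableT) => k _.
apply: integrableD => //.
- by have := integrable_norm (integrable_Re_mxderiv M k j).
- by have := integrable_norm (integrable_Im_mxderiv M k j).
Qed.

Lemma L2q_entry_bound (u : 'rV[C]_N) (e : R) t : (forall j, sqC (u 0 j) <= e) ->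
  `|Re (mxform (mxderiv M t) u u)| <= e * entry_bound t.
Proof.
move=> hu; rewrite Re_mxform mulr_sumr; apply: le_trans (ler_norm_sum _ _ _) _.
apply: ler_sum => j _; rewrite mulr_sumr; apply: le_trans (ler_norm_sum _ _ _) _.
apply: ler_sum => k _; apply: le_trans (ler_normB _ _) _.
rewrite !normrM mulrDr; have := hu j; have := hu k; rewrite /sqC.
case: (u 0 j) (u 0 k) => [a b] [c g] /= h1 h2.
(* These squares bound each real coefficient by half the sum of the two squared moduli, hence by
   [e]. *)
have amgm (x y : R) : (x - y) ^+ 2 >= 0 /\ (x + y) ^+ 2 >= 0 by rewrite !sqr_ge0.
apply: lerD; rewrite ler_wpM2r// ler_norml; apply/andP; split.
- by have := amgm c a; have := amgm g b; nra.
- by have := amgm c a; have := amgm g b; nra.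
- by have := amgm g a; have := amgm c b; nra.
- by have := amgm g a; have := amgm c b; nra.
Qed.

End L2_mult.

(** * Integration against a measure with a density *)

Section integral_density.
Context d (T : measurableType d) (R : realType).
Variables (nu mu : {measure set T -> \bar R}) (w : T -> R).
Hypotheses (w0 : forall t, 0 <= w t) (mw : measurable_fun setT w).
Hypothesis nuE : forall A, measurable A -> nu A = (\int[mu]_(t in A) (w t)%:E)%E.
Import HBNNSimple.

Let integral_density_nnsfun (f : {nnsfun T >-> R}) :
  (\int[nu]_t (f t)%:E = \int[mu]_t (f t * w t)%:E)%E.
Proof.
under [LHS]eq_integral do rewrite fimfunE -fsumEFin//.
rewrite [LHS]ge0_integral_fsum//; last 2 first.
  - by move=> r; exact/measurable_EFinP/measurableT_comp.
  - by move=> n x _; rewrite EFinM nnfun_muleindic_ge0.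
under [RHS]eq_integral.
  move=> x xD; rewrite EFinM fimfunE -fsumEFin// ge0_mule_fsuml; last first.
    by move=> r; rewrite EFinM nnfun_muleindic_ge0.
  over.
rewrite [RHS]ge0_integral_fsum//; last 2 first.
  - move=> r; apply: emeasurable_funM; last exact/measurable_EFinP.
    by apply/measurable_EFinP; exact: measurableT_comp.
  - move=> n x _; apply: mule_ge0; last by rewrite lee_fin.
    by rewrite EFinM nnfun_muleindic_ge0.
apply: eq_fsbigr => r _.
have mA : measurable (f @^-1` [set r]) by [].
(* Negative values are not attained; setting them apart leaves a nonnegative scalar to pull out of
   the integrals. *)
have [r0|r0] := ltP r 0.
  have A0 : f @^-1` [set r] = set0.
    by apply/seteqP; split => // t /= ft; have : 0 <= f t by []; rewrite ft leNgt r0.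
  under eq_integral do rewrite A0 indic0 mulr0.
  under [RHS]eq_integral do rewrite A0 indic0 mulr0 mul0e.
  by rewrite !integral0.
under eq_integral do rewrite EFinM.
under [RHS]eq_integral do rewrite EFinM -muleA.
rewrite !ge0_integralZl//; last first.
- exact/measurable_EFinP/measurable_indic.
- by move=> t _; rewrite mule_ge0// lee_fin.
- by apply: emeasurable_funM; exact/measurable_EFinP.
congr (_ * _)%E; rewrite integral_indic// setIT nuE// integral_mkcond.
apply: eq_integral => t _; rewrite patchE indicE.
by case: ifPn => _; rewrite ?mul1e ?mul0e.
Qed.

Lemma integral_density (f : T -> R) : measurable_fun setT f -> (forall t, 0 <= f t) ->
  (\int[nu]_t (f t)%:E = \int[mu]_t (f t * w t)%:E)%E.
Proof.
move=> /measurable_EFinP mf f0.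
pose f_ := nnsfun_approx measurableT mf.
have fE t : (fun n => (f_ n t)%:E) @ \oo --> (f t)%:E.
  by apply: (cvg_nnsfun_approx measurableT mf) => // x _; rewrite lee_fin.
transitivity (lim (\int[nu]_t (f_ n t)%:E @[n --> \oo])%E).
  rewrite -monotone_convergence//=.
  - by apply: eq_integral => t _; apply/esym/cvg_lim.
  - by move=> n; exact/measurable_EFinP.
  - by move=> n t _; rewrite lee_fin.
  - by move=> t _ m n mn; rewrite lee_fin; exact/lefP/nd_nnsfun_approx.
rewrite (_ : (fun n => _) = (fun n => \int[mu]_t (f_ n t * w t)%:E)%E); last first.
  by apply/funext => n; exact: integral_density_nnsfun.
rewrite -monotone_convergence//=.
- apply: eq_integral => t _; apply/cvg_lim => //.
  under eq_fun do rewrite EFinM.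
  by rewrite EFinM; apply: cvgeMr => //.
- by move=> n; apply/measurable_EFinP/measurable_funM.
- by move=> n t _; rewrite lee_fin mulr_ge0.
- move=> t _ m n mn; rewrite lee_fin ler_wpM2r//.
  by exact/lefP/nd_nnsfun_approx.
Qed.
End integral_density.

(** * Products of spectral projections *)

Section spectral_measure_facts.
Context (R : realType) (H : hilbertType R) d (T : measurableType d).
Local Notation C := R[i].
Variable E : spectral_measure H T.
Local Notation nm := (dnrm (@hdot R H)).

(** Countable additivity along [A], [B], [set0], [set0], and so on; the partial sums are constant
    from index 2. *)
Lemma spmU A B x : measurable A -> measurable B -> A `&` B = set0 ->
  E (A `|` B) x = E A x + E B x.
Proof.
move=> mA mB AB.
have mF i : measurable (bigcup2 A B i).
  by rewrite /bigcup2; case: ifP => // _; case: ifP.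
have tF : trivIset setT (bigcup2 A B).
  by rewrite -trivIset_bigcup2.
have := @spm_sigma _ _ _ _ E _ mF tF x; rewrite bigcup2E => h.
have h2 : (fun n => \sum_(0 <= i < n) E (bigcup2 A B i) x) @ \oo --> E A x + E B x.
  rewrite -(cvg_shiftn 2)/=; apply: cvg_near_cst; apply: nearW => n.
  rewrite addn2 big_nat_recl// big_nat_recl//= big1 ?addr0// => i _.
  by rewrite /bigcup2/= spm0.
exact: (cvg_unique (@norm_hausdorff _ H) h h2).
Qed.

(* If the sum of two projections P, Q is a projection then PQ + QP = 0, hence
   PQ = - PQP = QP, and PQ = 0. *)
Lemma spm_disjoint A B x : measurable A -> measurable B -> A `&` B = set0 ->
  E A (E B x) = 0.
Proof.
move=> mA mB AB; have mU := measurableU _ _ mA mB.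
have anti y : E A (E B y) + E B (E A y) = 0.
  have := @spm_idem _ _ _ _ E _ mU y.
  rewrite !spmU// !linearD /= !spm_idem// => h.
  apply: (addrI (E A y + E B y)); rewrite addr0 -[RHS]h.
  by rewrite addrACA [in RHS](addrC (E B (E A y))).
have h1 : E A (E B x) + E A (E B (E A x)) = 0.
  by have := congr1 (E A) (anti x); rewrite linearD linear0 /= spm_idem.
have h2 : E A (E B (E A x)) + E A (E B (E A x)) = 0.
  have := anti (E A x); rewrite spm_idem// => h.
  by have := congr1 (E A) h; rewrite linearD linear0 /= spm_idem.
have h3 : E A (E B (E A x)) = 0.
  move: h2; rewrite -mulr2n -(scaler_nat 2) => /eqP.
  by rewrite scaler_eq0 pnatr_eq0 => /eqP.
by move: h1; rewrite h3 addr0.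
Qed.

(** Both sets are split into their intersection and a remainder; all products of disjoint pieces
    vanish. *)
Lemma spmI A B x : measurable A -> measurable B -> E A (E B x) = E (A `&` B) x.
Proof.
move=> mA mB; have mAB := measurableI _ _ mA mB.
have mAD := measurableD mA mB; have mBD := measurableD mB mA.
have eA y : E A y = E (A `&` B) y + E (A `\` B) y.
  rewrite -spmU//; first by rewrite setUIDK.
  by apply/seteqP; split => // t [[_ ?] []].
have eB : E B x = E (A `&` B) x + E (B `\` A) x.
  rewrite -spmU//; first by rewrite setIC setUIDK.
  by apply/seteqP; split => // t [[? _] []].
rewrite eB linearD /= !eA spm_idem// (spm_disjoint _ mAD mAB); last first.
  by apply/seteqP; split => // t [[_ ?] []].
rewrite !spm_disjoint ?addr0//; apply/seteqP; split => // t.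
- by case=> [[_ nB] [/nB]].
- by case=> [[a _] [_ /(_ a)]].
Qed.

(** Pythagoras: [x - E A x] is orthogonal to [E A x]. *)
Lemma spm_contraction A x : measurable A -> nm (E A x) <= nm x.
Proof.
move=> mA; rewrite -ler_sqr ?nnegrE ?dnrm_ge0// !sqr_dnrm.
have := rdotD (@hdot R H) (x - E A x) (E A x); rewrite subrK => ->.
rewrite lerDr addr_ge0 ?rdot_ge0//.
rewrite (_ : rdot _ _ _ = 0) ?mulr0// /rdot -spm_sym//.
by rewrite linearB /= spm_idem// subrr linear0l.
Qed.

End spectral_measure_facts.

(** * The isometry *)

Section gram_space.
Context (R : realType) (H : hilbertType R) d (T : measurableType d).
Local Notation C := R[i].
Variables (E : spectral_measure H T) (N : nat) (x : 'I_N -> H).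
Local Notation M := (gram_measure E x).
Local Notation tau := (trace_measure M).
Local Notation nm := (dnrm (@hdot R H)).
Local Notation nL := (dnrm (L2dot M)).
Implicit Types (f g h : L2fun M) (u v : 'rV[C]_N).

(** The image under [V] of the constant function [u]. *)
Definition lincomb u : H := \sum_i u 0 i *: x i.

Lemma lincombZ c u : lincomb (c *: u) = c *: lincomb u.
Proof. by rewrite /lincomb scaler_sumr; apply: eq_bigr => i _; rewrite mxE scalerA. Qed.

Lemma mxform_gram A u v : mxform (M A) u v = '[E A (lincomb u), lincomb v].
Proof.
rewrite /mxform /form mxE [RHS]linear_sumr; apply: eq_bigr => j _.
rewrite !mxE [RHS]linearZr_LR/= mulrC; congr (_ * _).
rewrite (linear_sum (E A)) [RHS]linear_sumlz.
by apply: eq_bigr => i _; rewrite !mxE linearZ_LR [RHS]linearZl_LR.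
Qed.

Definition ind_rV (A : set T) u (t : T) : 'rV[C]_N := (\1_A t)%:C%C *: u.

Lemma L2fun_set_const u : L2fun_set M (fun=> u).
Proof.
split; first by move=> j; split; exact: measurable_cst.
by apply: integrable_lty => //; exact: integrable_Re_mxform.
Qed.

Lemma sqC_indic (A : set T) t : sqC (\1_A t)%:C%C <= 1 :> R.
Proof. by rewrite sqC_real indicE; case: (_ \in _); rewrite ?expr1n ?expr0n//= ler01. Qed.

Lemma L2fun_restrict A (f : T -> 'rV[C]_N) : measurable A -> L2fun_set M f ->
  L2fun_set M (fun t => (\1_A t)%:C%C *: f t).
Proof.
move=> mA lf; apply: (@L2fun_setM _ _ _ _ _ _ 1 _ _ _ lf).
  exact: cmeasurable_indic.
exact: sqC_indic.
Qed.

(** Moving [E B] to the other side produces the form of [M] at the intersection, which is the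
    integral of its density there. *)
Lemma rdot_ind A B u v f g : measurable A -> measurable B ->
  f = ind_rV A u :> (T -> _) -> g = ind_rV B v :> (T -> _) ->
  rdot (L2dot M) (L2class f) (L2class g) = rdot hdot (E A (lincomb u)) (E B (lincomb v)).
Proof.
move=> mA mB fE gE; rewrite rdot_L2class /rdot.
have -> : '[E A (lincomb u), E B (lincomb v)] = mxform (M (B `&` A)) u v.
  rewrite mxform_gram -spmI//; exact/esym/spm_sym.
rewrite /Rintegral -[RHS]/(fine (Re (mxform (M (B `&` A)) u v))%:E).
have mBA := measurableI _ _ mB mA.
apply: (congr1 (@fine R)).
apply: etrans _ (@integral_Re_mxform _ _ _ _ M u v _ mBA); rewrite [RHS]integral_mkcond.
apply: eq_integral => t _; rewrite patchE /L2form fE gE /ind_rV mxformZl mxformZr.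
rewrite !indicE in_setI; case: (t \in A); case: (t \in B) => /=;
  by rewrite ?conjC1 ?conjC0 ?mul1r ?mul0r ?mulr0.
Qed.

(* The graph of the map which sends the class of a simple function
   \sum_k 1_(A_k) u_k to \sum_k E A_k (\sum_i (u_k)_i x_i). *)
Inductive simple_graph : L2 M -> H -> Prop :=
| simple_ind A u f : measurable A -> f = ind_rV A u :> (T -> _) ->
    simple_graph (L2class f) (E A (lincomb u))
| simple_lin c F y G z : simple_graph F y -> simple_graph G z ->
    simple_graph (c *: F + G) (c *: y + z).

(** A class has many decompositions into indicators; induction on both derivations compares any two
    of them without a normal form. *)
Lemma simple_graph_dot F y G z : simple_graph F y -> simple_graph G z ->
  L2dot M F G = '[y, z].
Proof.
move=> sF sG; elim: sF => {F y} [A u f mA fE|c F y F' y' _ ihF _ ihF']; last first.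
  have -> : L2dot M (c *: F + F') G = c * L2dot M F G + L2dot M F' G.
    by rewrite linearDl linearZl_LR.
  by rewrite ihF ihF' [RHS]linearDl [X in _ = X + _]linearZl_LR.
elim: sG => {G z} [B v g mB gE|c F y F' y' _ ihF _ ihF']; last first.
  have -> : L2dot M (L2class f) (c *: F + F') =
      c^* * L2dot M (L2class f) F + L2dot M (L2class f) F'.
    by rewrite linearDr linearZr_LR.
  by rewrite ihF ihF' [RHS]linearDr [X in _ = X + _]linearZr_LR.
rewrite [LHS](form_dotE (L2dot M)) [RHS](form_dotE hdot).
congr Complex; first exact: rdot_ind.
(* The imaginary part is a real part against ['i *: v], again an indicator row. *)
rewrite -linearZ -lincombZ.
rewrite -[_ *: L2class g]/(L2scale _ _) -L2classZ.
apply: rdot_ind => //; rewrite /= gE; apply/funext => t.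
by rewrite /ind_rV /= [LHS]scalerA mulrC -scalerA.
Qed.

Lemma simple_graph0 : simple_graph 0 0.
Proof.
have := @simple_ind set0 0 0 measurable0; rewrite L2class0 spm0; apply.
by apply/funext => t; rewrite /ind_rV scaler0.
Qed.

Lemma simple_graphD F y G z : simple_graph F y -> simple_graph G z ->
  simple_graph (F + G) (y + z).
Proof. by move=> sF sG; have := simple_lin 1 sF sG; rewrite !scale1r. Qed.

Lemma simple_graphZ c F y : simple_graph F y -> simple_graph (c *: F) (c *: y).
Proof. by move=> sF; have := simple_lin c sF simple_graph0; rewrite !addr0. Qed.

Lemma simple_graph_sum (I : Type) (s : seq I) (F : I -> L2 M) :
  (forall i, exists y, simple_graph (F i) y) ->
  exists y, simple_graph (\sum_(i <- s) F i) y.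
Proof.
move=> sF; elim: s => [|i s [y ih]]; first by exists 0; rewrite big_nil; exact: simple_graph0.
by have [z hz] := sF i; exists (z + y); rewrite big_cons; exact: simple_graphD.
Qed.

Lemma L2class_sum (I : Type) (s : seq I) (f : I -> L2fun M) :
  L2class (\sum_(i <- s) f i) = \sum_(i <- s) L2class (f i).
Proof. exact: (big_morph _ (@L2classD _ _ _ _ M) (@L2class0 _ _ _ _ M)). Qed.

Lemma L2fun_sumE (I : Type) (s : seq I) (f : I -> L2fun M) t :
  (\sum_(i <- s) f i) t = \sum_(i <- s) f i t.
Proof.
exact: (big_morph (fun f : L2fun M => f t) (id1 := 0) (op1 := +%R)).
Qed.

Lemma simple_rows (s : 'I_N -> simple_fun R T) : exists2 r : L2fun M,
  (forall t, r t = \row_j sf_eval (s j) t) & exists y, simple_graph (L2class r) y.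
Proof.
have hB j (i : 'I_(sf_n (s j))) : exists f : L2fun M,
    f = ind_rV (sf_set i) (delta_mx 0 j) :> (T -> _).
  apply: L2fun_exists; apply: (L2fun_restrict _ (L2fun_set_const _)).
  exact: sf_meas.
pose b j := projT1 (choice (hB j)).
have bE j i : b j i = ind_rV (sf_set i) (delta_mx 0 j) :> (T -> _).
  by rewrite /b; case: choice.
exists (\sum_j \sum_i sf_val (s := s j) i *: b j i).
  move=> t; rewrite L2fun_sumE.
  rewrite [RHS]row_sum_delta; apply: eq_bigr => j _; rewrite L2fun_sumE mxE.
  rewrite /sf_eval scaler_suml; apply: eq_bigr => i _.
  by rewrite -[LHS]/(sf_val i *: b j i t) bE /ind_rV scalerA.
rewrite L2class_sum; apply: simple_graph_sum => j.
rewrite L2class_sum; apply: simple_graph_sum => i.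
rewrite L2classZ; exists (sf_val i *: E (sf_set i) (lincomb (delta_mx 0 j))).
by apply: simple_graphZ; apply: simple_ind => //; exact: sf_meas.
Qed.

End gram_space.

Lemma cvge0_lt_near (R : realType) (u : (\bar R)^nat) (e : R) : u @ \oo --> 0%E -> 0 < e ->
  \forall n \near \oo, (u n < e%:E)%E.
Proof.
move=> /fine_cvgP[ufin /cvgrPdist_lt u0] e0; near=> n.
have un : u n \is a fin_num by near: n.
rewrite -(fineK un) lte_fin; apply: le_lt_trans (ler_norm _) _.
by rewrite -normrN -[- _]add0r; near: n; exact: u0.
Unshelve. all: by end_near.
Qed.

Section gram_isometry.
Context (R : realType) (H : hilbertType R) d (T : measurableType d).
Local Notation C := R[i].
Variables (E : spectral_measure H T) (N : nat) (x : 'I_N -> H).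
Local Notation M := (gram_measure E x).
Local Notation tau := (trace_measure M).
Local Notation nm := (dnrm (@hdot R H)).
Local Notation nL := (dnrm (L2dot M)).
Implicit Types (f g h : L2fun M) (u v : 'rV[C]_N).

(** The approximants vanish off [A n], where the error density is that of [f]; on [A n] it is at
    most [entry_bound M t] divided by [n.+1]. [W] dominates both. *)
Lemma simple_graph_dense (F : L2 M) (e : R) : 0 < e ->
  exists2 p : L2 M * H, simple_graph p.1 p.2 & nL (F - p.1) < e.
Proof.
move=> e0; pose f := repr F; have FE : L2class f = F := L2class_repr F.
have mf : mxmeasurable f by apply/mxmeasurable_rV/(L2funP f).1.
pose S t := \sum_j sqC (f t 0 j).
have mS : measurable_fun setT S.
  by apply: measurable_sum => j; apply: measurable_sqC; exact: mf.
have S0 j t : sqC (f t 0 j) <= S t.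
  by rewrite /S (bigD1 j)//= lerDl sumr_ge0// => i _; exact: sqC_ge0.
pose A n := [set t | S t <= n%:R].
have mA n : measurable (A n).
  rewrite (_ : A n = setT `&` S @^-1` `]-oo, n%:R]%classic); first exact: mS.
  by rewrite setTI; apply/seteqP; split => t; rewrite /A /= in_itv.
have hs n j : exists s : simple_fun R T, forall t,
    (A n t -> sqC (sf_eval s t - f t 0 j) <= n.+1%:R^-1) /\ (~ A n t -> sf_eval s t = 0).
  (* On [A n] the squared moduli are at most [n], hence at most [n.+1 ^+ 2]. *)
  apply: (@simple_fun_approx _ _ _ _ _ n.+1%:R) => // t At.
  apply: le_trans (S0 j t) _; apply: le_trans At _.
  by rewrite -natrX ler_nat; apply: leq_trans (leqnSn n) _; rewrite -mulnn leq_pmulr.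
have hr n : exists r : L2fun M, (exists y, simple_graph (L2class r) y) /\ forall t,
    (A n t -> forall j, sqC ((f t - r t) 0 j) <= n.+1%:R^-1) /\ (~ A n t -> r t = 0).
  have [s hsn] := choice (hs n).
  have [r rE ry] := simple_rows E x s.
  exists r; split => // t; split=> At.
    move=> j; rewrite rE !mxE; apply: le_trans ((hsn j t).1 At).
    by rewrite -opprB -mulN1r sqCM /sqC /= oppr0 sqrrN expr1n expr0n/= addr0 mul1r.
  by rewrite rE; apply/rowP => j; rewrite !mxE (hsn j t).2.
have [r hr'] := choice hr.
pose W t := entry_bound M t + L2q M f t.
have iW : tau.-integrable setT (EFin \o W).
  exact: (integrableD measurableT (integrable_entry_bound M)
    (L2fun_integrable (L2funP f))).
have eb0 t : 0 <= entry_bound M t.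
  by apply: sumr_ge0 => j _; apply: sumr_ge0 => k _; rewrite addr_ge0.
have := @dominated_approx _ _ _ tau (fun n => L2q M (f - r n)) W A.
move=> /(_ _ iW _ _)/cvge0_lt_near/(_ (exprn_gt0 2 e0)) [].
- by move=> n; apply: measurable_L2form; exact: (L2funP (f - r n)).1.
- move=> t; exists (Num.truncn (S t)).+1 => n hn; rewrite /A /=.
  apply: ltW; apply: lt_le_trans (truncnS_gt _) _; by rewrite ler_nat.
- apply: filterS (ae_pos_form M) => t P0 n; have q0 := pos_form_Re P0 (f t).
  have h1 : A n t -> `|L2q M (f - r n) t| <= n.+1%:R^-1 * entry_bound M t.
    by move=> At; apply: L2q_entry_bound; exact: ((hr' n).2 t).1.
  have n0 : 0 <= (n.+1%:R^-1 : R) by rewrite invr_ge0.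
  have n1 : n.+1%:R^-1 <= (1 : R) by rewrite invf_le1// ler1n.
  split; last first.
    by move=> /h1 /le_trans; apply; rewrite ler_wpM2l// /W lerDl.
  have [At|At] := pselect (A n t).
    by apply: le_trans (h1 At) _; rewrite /W -[leLHS]addr0 lerD// ler_piMl.
  rewrite /L2q /L2form; have -> : (f - r n) t = f t.
    by rewrite -[LHS]/(f t - r n t) ((hr' n).2 t).2// subr0.
  by rewrite ger0_norm// /W lerDr.
move=> n _ /(_ n (leqnn n)); have [[y hy] _] := hr' n.
rewrite -(nsq_L2class (f - r n)) L2classD L2classN FE lte_fin.
rewrite ltr_sqr ?nnegrE ?dnrm_ge0 ?(ltW e0)// => h.
by exists (L2class (r n), y).
Qed.

Lemma gram_isometry_exists : exists V : {linear L2 M -> H},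
  (forall F, nm (V F) = nL F) /\
  forall A u f, measurable A -> f = ind_rV A u :> (T -> _) ->
    V (L2class f) = E A (lincomb x u).
Proof.
have [|||V [nV VE]] := @isometry_extension R (L2 M) (L2dot M) H
    [set p | simple_graph p.1 p.2].
- by move=> c p q sp sq; exact: simple_lin.
- move=> p sp; congr Num.sqrt.
  exact: (congr1 (@complex.Re R) (esym (simple_graph_dot sp sp))).
- by move=> F e e0; exact: simple_graph_dense.
exists V; split => // A u f mA fE.
exact: (VE (_, _) (simple_ind mA fE)).
Qed.

Section V.
Variable V : {linear L2 M -> H}.
Hypothesis nV : forall F, nm (V F) = nL F.
Hypothesis VE : forall A u f, measurable A -> f = ind_rV A u :> (T -> _) ->
  V (L2class f) = E A (lincomb x u).

Lemma gram_isometry_inj F G : V F = V G -> F = G.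
Proof.
move=> FG; apply/eqP; rewrite -subr_eq0; apply/eqP/(@dnrm0_eq0 _ _ (L2dot M)).
by rewrite -nV linearB FG subrr dnrm0.
Qed.

Lemma gram_isometry_simple F y : simple_graph F y -> V F = y.
Proof.
by elim=> [A u f mA /(VE mA)//|c {}F {}y G z _ Fy _ Gz]; rewrite linearP Fy Gz.
Qed.

Lemma gram_isometry_basis s : V (L2basis M s) = x s.
Proof.
rewrite /L2basis (VE (A := setT) (u := delta_mx 0 s))//.
  rewrite spmT /lincomb (bigD1 s)//= big1 => [|i si]; first by rewrite mxE !eqxx scale1r addr0.
  by rewrite mxE (negbTE si) andbF scale0r.
by apply/funext => t; rewrite /ind_rV indicT scale1r.
Qed.

Lemma simple_restrict F y A : simple_graph F y -> measurable A ->
  exists f g, [/\ F = L2class f, g = (fun t => (\1_A t)%:C%C *: f t) :> (T -> _) &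
    V (L2class g) = E A y].
Proof.
move=> + mA; elim=> {F y} [B u f mB fE|c F y G z _ + _ +]; last first.
  move=> [f [f' [-> f'E Vf']]] [g [g' [-> g'E Vg']]].
  exists (c *: f + g), (c *: f' + g'); split.
  - by rewrite L2classD L2classZ.
  - apply/funext => t; rewrite -[LHS]/(c *: f' t + g' t) f'E g'E.
    by rewrite -[(c *: f + g : L2fun M) t]/(c *: f t + g t) scalerDr !scalerA mulrC.
  - by rewrite L2classD L2classZ -[L2scale _ _]/(c *: L2class f') linearP Vf' Vg' linearP.
have [g gE] := L2fun_exists (L2fun_restrict mA (L2funP f)).
exists f, g; split => //; rewrite spmI//.
apply: VE; first exact: measurableI.
rewrite gE fE; apply/funext => t; rewrite /ind_rV scalerA -rmorphM/=.
by rewrite indicI.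
Qed.

(** Restriction and [E A] are both contractions, so the simple case [simple_restrict] extends by
    density. *)
Lemma gram_isometry_restrict A f g : measurable A ->
  g = (fun t => (\1_A t)%:C%C *: f t) :> (T -> _) ->
  V (L2class g) = E A (V (L2class f)).
Proof.
move=> mA gE; apply/eqP; rewrite -subr_eq0.
apply/eqP/(@dnrm_eps_eq0 _ _ (@hdot R H)) => e e0.
have [[F y] /= sFy] := simple_graph_dense (L2class f) (divr_gt0 e0 (ltr0n R 2)).
have [f1 [g1 [FE g1E Vg1]]] := simple_restrict sFy mA.
rewrite FE => fe; apply: le_lt_trans (dnrm_tri _ (V (L2class g1)) _ _) _.
rewrite [ltRHS]splitr ltr_leD//.
  rewrite -linearB nV; apply: le_lt_trans fe.
  rewrite -!L2classN -!L2classD; apply: dnrm_L2class_le => t.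
  have -> : L2q M (g - g1) t = sqC (\1_A t)%:C%C * L2q M (f - f1) t.
    rewrite -[RHS](L2q_mul M (fun t => (\1_A t)%:C%C) (f - f1) t) /L2q /L2form.
    have -> // : (g - g1) t = (\1_A t)%:C%C *: (f - f1) t.
    by rewrite -[LHS]/(g t - g1 t) gE g1E -scalerBr.
  by rewrite normrM ger0_norm ?sqC_ge0// ler_piMl// sqC_indic.
rewrite Vg1 -linearB; apply: le_trans (spm_contraction _ _ mA) _.
by rewrite -(gram_isometry_simple sFy) -linearB nV FE dnrmB ltW.
Qed.

End V.
End gram_isometry.

Lemma cvg_of_sqr (R : realType) (H : hilbertType R) (u : nat -> H) (y : H) :
  (fun n => (dnrm (@hdot R H) (y - u n) ^+ 2)%:E) @ \oo --> 0%E -> u @ \oo --> y.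
Proof.
move=> h; apply/cvg_dnrmP => e e0.
have := cvge0_lt_near h (exprn_gt0 2 e0); apply: filterS => n.
by rewrite lte_fin ltr_sqr ?nnegrE ?dnrm_ge0 ?(ltW e0).
Qed.

(** * Spectral integrals as multiplications *)

Section spectral_integral_isometry.
Context (R : realType) (H : hilbertType R) d (T : measurableType d).
Local Notation C := R[i].
Variables (E : spectral_measure H T) (N : nat) (x : 'I_N -> H).
Local Notation M := (gram_measure E x).
Local Notation tau := (trace_measure M).
Local Notation nm := (dnrm (@hdot R H)).
Local Notation nL := (dnrm (L2dot M)).
Implicit Types (f g h : L2fun M).
Variable V : {linear L2 M -> H}.
Hypothesis nV : forall F, nm (V F) = nL F.
Hypothesis VE : forall A u f, measurable A -> f = ind_rV A u :> (T -> _) ->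
  V (L2class f) = E A (lincomb x u).

Lemma gram_isometry_sf_integral (s : simple_fun R T) f : exists2 g : L2fun M,
  g = (fun t => sf_eval s t *: f t) :> (T -> _) &
  V (L2class g) = sf_integral E s (V (L2class f)).
Proof.
have hB (i : 'I_(sf_n s)) : exists g : L2fun M,
    g = (fun t => (\1_(sf_set i) t)%:C%C *: f t) :> (T -> _).
  by apply: L2fun_exists; apply: L2fun_restrict (L2funP f); exact: sf_meas.
have [b bE] := choice hB.
exists (\sum_i sf_val i *: b i).
  apply/funext => t; rewrite L2fun_sumE /sf_eval scaler_suml; apply: eq_bigr => i _.
  by rewrite -[LHS]/(sf_val i *: b i t) bE scalerA.
rewrite L2class_sum linear_sum; apply: eq_bigr => i _.
rewrite L2classZ -[L2scale _ _]/(sf_val i *: L2class (b i)) linearZ.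
by rewrite (gram_isometry_restrict nV VE (sf_meas i) (bE i)).
Qed.

(** Since [E A] acts as restriction, the left side is the scalar product of the restriction of [f]
    with [f]. The absolute value provides the everywhere nonnegative density that [integral_density]
    asks for. *)
Lemma scalar_measureE f A : measurable A ->
  scalar_measure E (V (L2class f)) A = (\int[tau]_(t in A) (`|L2q M f t|)%:E)%E.
Proof.
move=> mA; rewrite /scalar_measure /trace_measure asboolT// big_ord1 mxE.
have [g gE] := L2fun_exists (L2fun_restrict mA (L2funP f)).
have -> : Re '[E A (V (L2class f)), V (L2class f)] = \int[tau]_t (Re (L2form M g f t)).
  rewrite -(gram_isometry_restrict nV VE mA gE) -rdot_L2class.
  exact: (congr1 (@complex.Re R) (isometry_dnrm nV _ _)).
rewrite /Rintegral fineK; last first.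
  by apply: (integrable_fin_num measurableT); apply: L2form_integrable; exact: L2funP.
have mf := (L2funP f).1.
have absA : (\int[tau]_(t in A) (`|L2q M f t|)%:E = \int[tau]_(t in A) (L2q M f t)%:E)%E.
  apply: ae_eq_integral => //.
  - apply: measurable_funTS; apply/measurable_EFinP/measurableT_comp => //.
    exact: measurable_L2q.
  - apply: measurable_funTS; apply/measurable_EFinP; exact: measurable_L2q.
  - by apply: filterS (ae_L2form_ge0 M f) => t h _; rewrite ger0_norm.
apply: etrans (esym absA); rewrite [RHS]integral_mkcond; apply: eq_integral => t _.
rewrite patchE /L2form gE mxformZl indicE; case: (t \in A) => /=.
  by rewrite mul1r.
by rewrite mul0r.
Qed.

Lemma integral_scalar_measure f (p : T -> R) : measurable_fun setT p -> (forall t, 0 <= p t) ->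
  (\int[scalar_measure E (V (L2class f))]_t (p t)%:E = \int[tau]_t (p t * `|L2q M f t|)%:E)%E.
Proof.
move=> mp p0; apply: integral_density => //.
- by apply: measurableT_comp => //; apply: measurable_L2q; exact: (L2funP f).1.
- exact: scalar_measureE.
Qed.

(** Together with [integral_scalar_measure], this identifies the two convergences in the definition
    of [spectral_integral] as one and the same distance. *)
Lemma sf_integral_dist (g : T -> C) (s : simple_fun R T) f h : cmeasurable g ->
  h = (fun t => g t *: f t) :> (T -> _) ->
  ((nm (V (L2class h) - sf_integral E s (V (L2class f))) ^+ 2)%:E =
   \int[tau]_t (sqC (sf_eval s t - g t) * `|L2q M f t|)%:E)%E.
Proof.
move=> mg hE; have [k kE <-] := gram_isometry_sf_integral s f.
rewrite -linearB nV dnrmB -L2classN -L2classD (nsq_L2class (k - h)).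
rewrite -(integral_abs_L2q M (L2funP (k - h)).1); apply: eq_integral => t _; congr EFin.
have -> : L2q M (k - h) t = L2q M (fun t => (sf_eval s t - g t) *: f t) t.
  rewrite /L2q /L2form.
  have -> // : (k - h) t = (sf_eval s t - g t) *: f t.
  by rewrite -[LHS]/(k t - h t) kE hE scalerBl.
by rewrite L2q_mul normrM ger0_norm// sqC_ge0.
Qed.

Lemma measurable_sf_dist (g : T -> C) (s : simple_fun R T) : cmeasurable g ->
  measurable_fun setT (fun t => sqC (sf_eval s t - g t)).
Proof.
by move=> mg; apply: measurable_sqC; apply: cmeasurableB => //; exact: cmeasurable_sf_eval.
Qed.

(** From left to right, a single [s n] at finite distance suffices: [g f = s f - (s - g) f], with
    both terms square integrable. Conversely, [g] is approximated on the sets where it is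
    bounded. *)
Lemma spectral_integralP (g : T -> C) f z : cmeasurable g ->
  spectral_integral E g (V (L2class f), z) <->
  exists2 h : L2fun M, h = (fun t => g t *: f t) :> (T -> _) & z = V (L2class h).
Proof.
move=> mg.
have key (s : nat -> simple_fun R T) h : h = (fun t => g t *: f t) :> (T -> _) ->
    (fun n => \int[tau]_t (sqC (sf_eval (s n) t - g t) * `|L2q M f t|)%:E)%E @ \oo --> 0%E ->
    (fun n => sf_integral E (s n) (V (L2class f))) @ \oo --> V (L2class h).
  move=> hE hs; apply: cvg_of_sqr; rewrite (_ : (fun n => _) = (fun n =>
    \int[tau]_t (sqC (sf_eval (s n) t - g t) * `|L2q M f t|)%:E)%E)//.
  by apply/funext => n; exact: sf_integral_dist.
have muE (s : simple_fun R T) : (\int[scalar_measure E (V (L2class f))]_t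
      ((Re (sf_eval s t - g t)) ^+ 2 + (Im (sf_eval s t - g t)) ^+ 2)%:E
    = \int[tau]_t (sqC (sf_eval s t - g t) * `|L2q M f t|)%:E)%E.
  rewrite -integral_scalar_measure//; first exact: measurable_sf_dist.
  by move=> t; exact: sqC_ge0.
split=> [[s [/= s1 s2]]|[h hE ->]].
  have {}s1 : (fun n => \int[tau]_t (sqC (sf_eval (s n) t - g t) * `|L2q M f t|)%:E)%E
      @ \oo --> 0%E.
    by move: s1; under eq_fun do rewrite muE.
  have [n _ /(_ n (leqnn n)) sn] := cvge0_lt_near s1 ltr01.
  have [k kE _] := gram_isometry_sf_integral (s n) f.
  have mD : measurable_rV (fun t => (sf_eval (s n) t - g t) *: f t).
    have [m1 m2] := cmeasurableB (cmeasurable_sf_eval (s n)) mg.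
    by apply: measurable_rVZ => //; exact: (L2funP f).1.
  have lD : L2fun_set M (fun t => (sf_eval (s n) t - g t) *: f t).
    split => //; rewrite -[X in (X < _)%E](integral_abs_L2q M mD).
    apply: lt_trans (ltry 1); apply: le_lt_trans sn.
    rewrite le_eqVlt; apply/orP; left; apply/eqP; apply: eq_integral => t _.
    by rewrite L2q_mul normrM ger0_norm// sqC_ge0.
  have [D DE] := L2fun_exists lD.
  have hE : (k - D : L2fun M) = (fun t => g t *: f t) :> (T -> _).
    apply/funext => t; rewrite -[LHS]/(k t - D t) kE DE -scalerBl.
    by rewrite opprB addrCA subrr addr0.
  exists (k - D) => //; apply: (cvg_unique (@norm_hausdorff _ H) s2).
  exact: (key s (k - D)).
pose A n := [set t | sqC (g t) <= n%:R].
have mA n : measurable (A n).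
  rewrite (_ : A n = setT `&` (fun t => sqC (g t)) @^-1` `]-oo, n%:R]%classic).
    exact: measurable_sqC.
  by rewrite setTI; apply/seteqP; split => t; rewrite /A /= in_itv.
have hs n : exists s : simple_fun R T, forall t,
    (A n t -> sqC (sf_eval s t - g t) <= n.+1%:R^-1) /\ (~ A n t -> sf_eval s t = 0).
  apply: (@simple_fun_approx _ _ _ _ _ n.+1%:R) => // t At.
  apply: le_trans At _.
  by rewrite -natrX ler_nat; apply: leq_trans (leqnSn n) _; rewrite -mulnn leq_pmulr.
have [s sE] := choice hs.
have hq t : `|L2q M h t| = sqC (g t) * `|L2q M f t|.
  rewrite -{1}[sqC (g t)]ger0_norm ?sqC_ge0// -normrM; congr `|_|.
  by rewrite -L2q_mul /L2q /L2form hE.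
have mq (k : L2fun M) : measurable_fun setT (L2q M k).
  by apply: measurable_L2q; exact: (L2funP k).1.
have hcv : (fun n => \int[tau]_t (sqC (sf_eval (s n) t - g t) * `|L2q M f t|)%:E)%E
    @ \oo --> 0%E.
  apply: (@dominated_approx _ _ _ tau _ (fun t => `|L2q M f t| + `|L2q M h t|) A).
  - move=> n; apply: measurable_funM; first exact: measurable_sf_dist.
    by apply: measurableT_comp.
  - exact: (integrableD measurableT (integrable_norm (L2fun_integrable (L2funP f)))
      (integrable_norm (L2fun_integrable (L2funP h)))).
  - move=> t; exists (Num.truncn (sqC (g t))).+1 => n hn; rewrite /A /=.
    by apply: ltW; apply: lt_le_trans (truncnS_gt _) _; rewrite ler_nat.
  - apply: nearW => t n; rewrite ger0_norm ?mulr_ge0 ?sqC_ge0//.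
    have n0 : 0 <= (n.+1%:R^-1 : R) by rewrite invr_ge0.
    have n1 : n.+1%:R^-1 <= (1 : R) by rewrite invf_le1// ler1n.
    have h1 : A n t -> sqC (sf_eval (s n) t - g t) * `|L2q M f t| <= n.+1%:R^-1 * `|L2q M f t|.
      by move=> At; rewrite ler_wpM2r//; exact: (sE n t).1.
    split; last by move=> /h1 /le_trans; apply; rewrite ler_wpM2l// lerDl.
    have [At|At] := pselect (A n t).
      by apply: le_trans (h1 At) _; rewrite -[leLHS]addr0 lerD// ler_piMl.
    (* Off [A n] the simple function is 0, so the error is exactly the density of [h]. *)
    rewrite (sE n t).2// sub0r hq -mulN1r sqCM {1}/sqC /= oppr0 sqrrN.
    by rewrite expr1n expr0n/= addr0 mul1r lerDr.
exists s; split => /=; last exact: key.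
by under eq_fun do rewrite muE.
Qed.

(** An equality of graphs, hence also of domains: [spectral_integralP] says that [V F] lies in the
    domain of the integral exactly when [g f] is square integrable, [f] representing [F]. *)
Lemma spectral_integral_range (g : T -> C) : cmeasurable g ->
  ((graph V)^-1 \; spectral_integral E g \; graph V)%relation = L2mul M g.
Proof.
move=> mg; apply/seteqP; split=> [[F G]|[F G] [f [h [hE [-> ->]]]]] /=.
  rewrite /graph /= => -[z [_ -> SE] zE].
  rewrite -(L2class_repr F) in SE *.
  have [h hE zh] := (spectral_integralP (repr F) z mg).1 SE.
  exists (repr F), h; split; first by move=> t; rewrite hE.
  by congr pair; apply: (gram_isometry_inj nV); rewrite -zE.
exists (V (L2class h)) => //; exists (V (L2class f)) => //.
by apply/(spectral_integralP f _ mg); exists h => //; exact/funext.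
Qed.

Lemma gram_isometry_range_closed (y : H) :
  (forall e, 0 < e -> exists F, nm (y - V F) < e) -> exists F, V F = y.
Proof.
move=> hy; have p4 n : 0 < 4^-1 ^+ n :> R by rewrite exprn_gt0// invr_gt0.
(* The factor 1/2 makes consecutive distances at most [(1/8 + 1/2) * 4 ^- n], within the rate that
   [L2_fast_cauchy] requires. *)
have hn n : exists F, nm (y - V F) < 2^-1 * 4^-1 ^+ n.
  by apply: hy; rewrite mulr_gt0 ?invr_gt0.
have [F hF] := choice hn.
have fast n : nL (L2class (repr (F n.+1)) - L2class (repr (F n))) <= 4^-1 ^+ n.
  rewrite !L2class_repr -nV linearB; apply: le_trans (dnrm_tri _ y _ _) _.
  rewrite (dnrmB _ _ y); have h1 := hF n; have h2 := hF n.+1.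
  apply: ltW; apply: lt_le_trans (ltrD h2 h1) _; rewrite exprS; have := p4 n.
  by move: (4^-1 ^+ n) => q; lra.
have [G hG] := L2_fast_cauchy fast.
exists G; apply/eqP; rewrite -subr_eq0; apply/eqP/(@dnrm_eps_eq0 _ _ (@hdot R H)) => e e0.
(* The final estimate is [(2 + 1/2) * 4 ^- m]; 4 leaves slack. *)
have [m hm] : exists m, 4 * 4^-1 ^+ m < e.
  have := @cvg_geometric R 4 4^-1.
  rewrite ger0_norm ?invr_ge0// invf_lt1// ltr1n => /(_ isT) /cvgrPdist_lt /(_ e e0)[m _ hm].
  exists m; have := hm m (leqnn m); rewrite /= sub0r normrN ger0_norm//.
apply: le_lt_trans hm; apply: le_trans (dnrm_tri _ (V (F m)) _ _) _.
rewrite (dnrmB _ _ y) -linearB nV (dnrmB _ G).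
have h1 := hG m; rewrite L2class_repr in h1.
apply: le_trans (lerD h1 (ltW (hF m))) _; have := p4 m.
by move: (4^-1 ^+ m) => q; lra.
Qed.

End spectral_integral_isometry.

(** * Invariance of a set under relations *)

Section invariant_sets.
Context (T : Type) (K : set T).

Definition rel_invariant (B : set (T * T)) := forall y z, B (y, z) -> K y -> K z.

Lemma rel_invariant_id : rel_invariant (graph id).
Proof. by move=> y z; rewrite /graph /= => ->. Qed.

Lemma rel_invariant_comp B B' : rel_invariant B -> rel_invariant B' ->
  rel_invariant (B \; B')%relation.
Proof. by move=> iB iB' y z [w /iB' yw /iB wz] /yw/wz. Qed.

Lemma rel_invariant_pow B n : rel_invariant B -> rel_invariant (op_pow B n).
Proof.
move=> iB; elim: n => [|n ih]; first exact: rel_invariant_id.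
exact: rel_invariant_comp.
Qed.

Lemma rel_invariant_zpow B n : rel_invariant B -> rel_invariant (B^-1)%relation ->
  rel_invariant (op_zpow B n).
Proof. by case: n => n iB iB'; exact: rel_invariant_pow. Qed.

Lemma rel_invariant_prod n (B : 'I_n -> set (T * T)) :
  (forall i, rel_invariant (B i)) -> rel_invariant (op_prod B).
Proof.
move=> iB; rewrite /op_prod; elim/big_ind: _ => //; first exact: rel_invariant_id.
exact: rel_invariant_comp.
Qed.
End invariant_sets.

(** * Coordinate functions on the spectral space *)

Section coordinates.
Context (R : realType) (r l : nat).

Lemma cmeasurable_xcoord (j : 'I_r) : cmeasurable (@xcoord R r l j).
Proof.
apply: cmeasurable_real.
apply: (@measurableT_comp _ _ _ _ _ _ (fun u : r.-tuple R => tnth u j)).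
  exact: measurable_tnth.
exact: measurable_fst.
Qed.

Lemma measurable_angle : measurable_fun setT (fun t : angle R => sval t : R).
Proof.
move=> _ B mB; exists B => //.
Qed.

Lemma cmeasurable_expcoord (k : 'I_l) : cmeasurable (@expcoord R r l k).
Proof.
have mk : measurable_fun setT (fun u : Dspace R r l => sval (tnth u.2 k) : R).
  apply: (@measurableT_comp _ _ _ _ _ _ (fun t : angle R => sval t : R)).
    exact: measurable_angle.
  apply: (@measurableT_comp _ _ _ _ _ _ (fun u : l.-tuple (angle R) => tnth u k)).
    exact: measurable_tnth.
  exact: measurable_snd.
by split; apply: measurableT_comp => //; apply: continuous_measurable_fun;
  [exact: continuous_cos|exact: continuous_sin].
Qed.

Lemma expcoord_mulVr (k : 'I_l) (u : Dspace R r l) :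
  expcoord k u * (expcoord k u)^* = 1.
Proof.
rewrite /expcoord; set a := sval _; have := cos2Dsin2 a.
by move=> h; apply/eqP; rewrite eq_complex/=; apply/andP; split; apply/eqP; rewrite -?h; ring.
Qed.

Lemma sqC_expcoord_conj (k : 'I_l) (u : Dspace R r l) : sqC (expcoord k u)^* = 1.
Proof. by rewrite /sqC /expcoord /= sqrrN cos2Dsin2. Qed.

End coordinates.

(** * Unitary equivalence with multiplication operators *)

Theorem theorem1 (R : realType) (H : hilbertType R) (r l : nat)
    (A : SU_set H r l) (E : spectral_measure H (Dspace R r l))
    (d N : nat) (x : 'I_N -> H) :
  (r + l != 0)%N ->
  SU_commuting A ->
  SU_multiplicity A d ->
  SU_spectral_measure A E ->
  (0 < N)%N -> (d <= N)%N ->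
  SU_generating A x ->
  exists V : {linear L2 (gram_measure E x) -> H},
    [/\ unitary (L2dot (gram_measure E x)) hdot V,
        forall j : 'I_r,
          ((graph V)^-1 \; suS A j \; graph V)%relation
            = L2mul (gram_measure E x) (xcoord j),
        forall k : 'I_l,
          ((graph V)^-1 \; graph (suU A k) \; graph V)%relation
            = L2mul (gram_measure E x) (expcoord k)
      & forall s : 'I_N, V (L2basis (gram_measure E x) s) = x s].
Proof.
move=> _ _ _ [SE UE] _ _ [_ gen].
have [V [nV VE]] := gram_isometry_exists E x.
have mX j : cmeasurable (@xcoord R r l j) by exact: cmeasurable_xcoord.
have mW k : cmeasurable (@expcoord R r l k) by exact: cmeasurable_expcoord.
exists V; split; last exact: gram_isometry_basis.
- split; first exact: isometry_dnrm.
  pose K := [set y | exists F, V F = y].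
  have invI g : cmeasurable g -> rel_invariant K (spectral_integral E g).
    move=> mg y z yz [F Fy]; rewrite -Fy -(L2class_repr F) in yz.
    have [h _ ->] := (spectral_integralP nV VE _ _ mg).1 yz.
    by exists (L2class h).
  have invS j : rel_invariant K (suS A j) by rewrite SE; exact: invI.
  have invU k : rel_invariant K (graph (suU A k)) by rewrite UE; exact: invI.
  (* The span contains negative powers of the unitaries. Dividing by [expcoord k] is multiplying by
     its conjugate, a bounded multiplier, so a preimage under [suU A k] can be found within the
     range of [V]. *)
  have invUV k : rel_invariant K ((graph (suU A k))^-1)%relation.
    move=> y z zy [F Fy].
    have [g gE] : exists g : L2fun (gram_measure E x),
        g = (fun t => (expcoord k t)^* *: repr F t) :> (_ -> _).
      apply: L2fun_exists; apply: (@L2fun_setM _ _ _ _ _ _ 1); last exact: L2funP.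
        exact: cmeasurable_conj.
      by move=> t; rewrite sqC_expcoord_conj.
    have : graph (suU A k) (V (L2class g), V (L2class (repr F))).
      rewrite UE; apply/(spectral_integralP nV VE _ _ (mW k)).
      exists (repr F) => //; apply/funext => t.
      by rewrite gE scalerA expcoord_mulVr scale1r.
    rewrite L2class_repr Fy; move: zy; rewrite /graph /= => -> Uzg.
    (* [suU A k] sends both [z] and [V (L2class g)] to [y]; being isometric, it is injective. *)
    exists (L2class g); apply/eqP; rewrite -subr_eq0; apply/eqP.
    apply: (@dnrm0_eq0 _ _ (@hdot R H)).
    have [iU _] := suU_unitary A k.
    have := congr1 (@complex.Re R) (iU (V (L2class g) - z) (V (L2class g) - z)).
    rewrite linearB /= Uzg subrr => h; rewrite /dnrm /rdot -h.
    by rewrite linear0l sqrtr0.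
  have basis i : K (x i) by exists (L2basis (gram_measure E x) i); exact: gram_isometry_basis.
  have span y : lin_span [set y | exists m n i,
      (SU_Umon A n \; SU_Smon A m)%relation (x i, y)] y -> K y.
    move=> [n [a [v [hv ->]]]].
    have /choice[F hF] : forall i, exists F, V F = v i.
      move=> i; have [m [p [j]]] := hv i => h.
      apply: (rel_invariant_comp _ _ h (basis j)).
      - by apply: rel_invariant_prod => k; apply: rel_invariant_zpow.
      - by apply: rel_invariant_prod => k; apply: rel_invariant_pow.
    exists (\sum_i a i *: F i); rewrite linear_sum; apply: eq_bigr => i _.
    by rewrite linearZ hF.
  move=> y; apply: (gram_isometry_range_closed nV) => e e0.
  have : closure (lin_span [set y | exists m n i,
      (SU_Umon A n \; SU_Smon A m)%relation (x i, y)]) y by rewrite gen.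
  have e0' : 0 < e%:C%C :> R[i] by rewrite ltcR.
  move=> /(_ _ (nbhsx_ballx y _ e0'))[z [/span[F <-]]].
  by rewrite -ball_normE /= normE ltcR => h; exists F.
- by move=> j; rewrite SE; exact: spectral_integral_range.
- by move=> k; rewrite UE; exact: spectral_integral_range.
Qed.
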